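(* Let $p$ be a prime and let $G$ be a finite $p$-group with exponent $\exp(G)=p^e$. Then: (a) if $G$ is potent, then $\exp(\nu(G))$ divides $p^{e+1}$; (b) if $p$ is odd and $\gamma_{p-2}(G)\leqslant G^p$, then $\nu(G)$ is a potent $p$-group; in particular, $\exp(\nu(G))=p^e$.
   Context: Notation: $x^y = y^{-1}xy$ and $[x,y]$ is the group commutator. For a group $G$, let $\varphi: G \to G^{\varphi}$, $g \mapsto g^{\varphi}$, be an isomorphism onto a copy $G^{\varphi}$ of $G$. Define $$\nu(G) = \langle G \cup G^{\varphi} \mid [g_1,g_2^{\varphi}]^{g_3} = [g_1^{g_3},(g_2^{g_3})^{\varphi}] = [g_1,g_2^{\varphi}]^{g_3^{\varphi}},\ g_1,g_2,g_3 \in G\rangle,$$ where the relations of $G$ and of $G^{\varphi}$ are also understood to hold (so $\nu(G)$ is a quotient of the free product $G * G^{\varphi}$). For a $p$-group $H$ and an integer $m\ge 1$, $H^{m}$ denotes the subgroup generated by all $h^m$, $h \in H$; $H'=\gamma_2(H)=[H,H]$; $\gamma_1(H)=H$ and $\gamma_{k+1}(H)=[\gamma_k(H),H]$. The exponent of $H$ is denoted $\exp(H)$. A finite $p$-group $H$ is potent if $p>2$ and $\gamma_{p-1}(H)\leqslant H^p$, or $p=2$ and $H'\leqslant H^4$. *)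

(* Defs.v *)
From HB Require Import structures.
From mathcomp Require Import all_boot all_fingroup all_solvable.
From mathcomp Require Import boolp generic_quotient.

Set Implicit Arguments.
Unset Strict Implicit.
Unset Printing Implicit Defensive.

Local Open Scope group_scope.
Local Open Scope quotient_scope.

Section Nu.

Variable G : groupType.

(* The letters are the elements g (as inl g) and g^phi (as inr g) of the two
   copies of G.  They are closed under inversion, so no formal inverses of
   letters are needed. *)
Definition letter_inv (l : G + G) : G + G :=
  match l with inl g => inl g^-1 | inr g => inr g^-1 end.

Definition word_inv (w : seq (G + G)) := rev (map letter_inv w).

Definition word_conj (u v : seq (G + G)) := word_inv v ++ u ++ v.

Definition word_comm (u v : seq (G + G)) :=
  word_inv u ++ word_inv v ++ u ++ v.

(* The congruence on words generated by the multiplication tables of the two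
   copies of G (whose quotient is the free product of the copies), together
   with the relations
     [a, b^phi]^c = [a^c, (b^c)^phi] = [a, b^phi]^(c^phi). *)
Inductive nu_eq : seq (G + G) -> seq (G + G) -> Prop :=
| nu_eq_refl u : nu_eq u u
| nu_eq_sym u v : nu_eq u v -> nu_eq v u
| nu_eq_trans u v w : nu_eq u v -> nu_eq v w -> nu_eq u w
| nu_eq_cat u u' v v' : nu_eq u u' -> nu_eq v v' -> nu_eq (u ++ v) (u' ++ v')
| nu_eq_1l : nu_eq [:: inl 1] [::]
| nu_eq_1r : nu_eq [:: inr 1] [::]
| nu_eq_Ml a b : nu_eq [:: inl a; inl b] [:: inl (a * b)]
| nu_eq_Mr a b : nu_eq [:: inr a; inr b] [:: inr (a * b)]
| nu_eq_Jl a b c :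
    nu_eq (word_conj (word_comm [:: inl a] [:: inr b]) [:: inl c])
          (word_comm [:: inl (a ^ c)] [:: inr (b ^ c)])
| nu_eq_Jr a b c :
    nu_eq (word_comm [:: inl (a ^ c)] [:: inr (b ^ c)])
          (word_conj (word_comm [:: inl a] [:: inr b]) [:: inr c]).

Definition nu_rel (u v : seq (G + G)) : bool := `[< nu_eq u v >].

Lemma nu_rel_equiv : equiv_class_of nu_rel.
Proof.
split=> [u|u v|v u w].
- by apply/asboolP; exact: nu_eq_refl.
- by apply/asboolP/asboolP; exact: nu_eq_sym.
- by move=> /asboolP uv /asboolP vw; apply/asboolP; exact: nu_eq_trans uv vw.
Qed.

Canonical nu_equiv := EquivRelPack nu_rel_equiv.

Definition nu := {eq_quot nu_equiv}.

HB.instance Definition _ := EqQuotient.on nu.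
HB.instance Definition _ := Choice.on nu.

Definition nu_one : nu := \pi_nu [::].
Definition nu_mul (x y : nu) : nu := \pi_nu (repr x ++ repr y).
Definition nu_inv (x : nu) : nu := \pi_nu (word_inv (repr x)).

Lemma nu_piP u v : nu_eq u v <-> \pi_nu u = \pi_nu v.
Proof.
split=> [uv|/eqP]; first by apply/eqP; rewrite eqmodE; apply/asboolP.
by rewrite eqmodE => /asboolP.
Qed.

Lemma nu_repr u : nu_eq (repr (\pi_nu u)) u.
Proof. by apply/nu_piP; rewrite reprK. Qed.

Lemma nu_mul_pi u v : nu_mul (\pi_nu u) (\pi_nu v) = \pi_nu (u ++ v).
Proof. by apply/nu_piP; apply: nu_eq_cat; exact: nu_repr. Qed.

Lemma nu_mulA : associative nu_mul.
Proof.
move=> x y z; rewrite -[x]reprK -[y]reprK -[z]reprK.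
move: (repr x) (repr y) (repr z) => u v w.
by rewrite (nu_mul_pi u v) (nu_mul_pi v w) !nu_mul_pi catA.
Qed.

Lemma nu_mul1 : left_id nu_one nu_mul.
Proof. by move=> x; rewrite -[x]reprK nu_mul_pi. Qed.

Lemma nu_mulr1 : right_id nu_one nu_mul.
Proof. by move=> x; rewrite -[x]reprK nu_mul_pi cats0. Qed.

Lemma letter_invK : involutive letter_inv.
Proof. by case=> g /=; rewrite invgK. Qed.

Lemma word_invK : involutive word_inv.
Proof.
move=> w; rewrite /word_inv map_rev revK -map_comp map_id_in // => l _.
exact: letter_invK.
Qed.

Lemma nu_eq_letterV l : nu_eq [:: letter_inv l; l] [::].
Proof.
case: l => g /=.
  by apply: nu_eq_trans (nu_eq_Ml _ _) _; rewrite mulVg; exact: nu_eq_1l.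
by apply: nu_eq_trans (nu_eq_Mr _ _) _; rewrite mulVg; exact: nu_eq_1r.
Qed.

Lemma nu_eq_wordV w : nu_eq (word_inv w ++ w) [::].
Proof.
elim: w => [|l w IHw]; first exact: nu_eq_refl.
rewrite /word_inv map_cons rev_cons cat_rcons.
apply: nu_eq_trans IHw; apply: nu_eq_cat; first exact: nu_eq_refl.
exact: nu_eq_cat (nu_eq_letterV l) (nu_eq_refl w).
Qed.

Lemma nu_mulV : left_inverse nu_one nu_inv nu_mul.
Proof.
move=> x; rewrite -{2}[x]reprK /nu_inv nu_mul_pi.
by apply/nu_piP; exact: nu_eq_wordV.
Qed.

Lemma nu_mulrV : right_inverse nu_one nu_inv nu_mul.
Proof.
move=> x; rewrite -{1}[x]reprK /nu_inv nu_mul_pi.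
by apply/nu_piP; rewrite -{1}[repr x]word_invK; exact: nu_eq_wordV.
Qed.

HB.instance Definition _ :=
  isGroup.Build nu nu_mulA nu_mul1 nu_mulr1 nu_mulV nu_mulrV.

End Nu.

(* exponent (from abelian.v) is only available for finite groups. *)
Definition has_exponent (N : groupType) (n : nat) : Prop :=
  [/\ (0 < n)%N, forall x : N, x ^+ n = 1 &
      forall m, (0 < m)%N -> (forall x : N, x ^+ m = 1) -> (n <= m)%N].

Section Potent.

Variable gT : finGroupType.

Definition power_subgroup (m : nat) (H : {set gT}) : {set gT} :=
  <<[set x ^+ m | x in H]>>.

Definition potent_pgroup (p : nat) (H : {set gT}) : bool :=
  p.-group H &&
  (if p == 2 then H^`(1) \subset power_subgroup 4 H
   else 'L_p.-1(H) \subset power_subgroup p H).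

End Potent.

(* A groupType N carries no finiteness: N is a finite potent p-group when it is
   isomorphic to some finGroupType which is one. *)
Definition is_potent_pgroup (p : nat) (N : groupType) : Prop :=
  exists (K : finGroupType) (f : {multiplicative K -> N}),
    bijective f /\ potent_pgroup p [set: K].

(* Main.v *)
(* In N = nu(G) the element [g, h^phi] acts on G^phi as [g, h] does and
   on G as [g, h]^phi does, whence gamma_(n+1)(N) = [gamma_n(G), N] [gamma_n(G^phi), N].
   Let X be the set of conjugates of elements of G and of G^phi, and let U_k = [P_k, N]
   with P_k generated by the p^k-th powers of elements of X.  Potency of G implies
   [U_0, N, ..., N] <= U_s with d = p - 2 copies of N and s = 1 if p is odd, and
   with d = 1 and s = 2 if p = 2; Hall's collection formula propagates this to
   [U_k, N, ..., N] <= U_(k+s) for all k.  In the collection formula for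
   (xy)^(p^r) the factor of weight m is raised to a multiple of p^(r-v_p(m)) and
   lies in a layer deep enough to be killed by it, so each U_k has exponent
   dividing p^(e-k); applied once more to products of elements of X, the same
   formula bounds the exponent of N by p^e for p odd and by 2^(e+1) for p = 2.

   The group N is finite because it is generated by finitely many elements of
   finite order and the kernel of the map N -> G x G x G sending g to (g, 1, g)
   and g^phi to (1, g, g) is central: the transfer into that kernel is a
   homomorphism, which forces the kernel to have bounded exponent. *)

From HB Require Import structures.
Require Import Defs.
From mathcomp Require Import all_boot all_fingroup all_solvable.
From mathcomp Require Import zify.
From mathcomp Require Import boolp generic_quotient.

Set Implicit Arguments.
Unset Strict Implicit.
Unset Printing Implicit Defensive.

Local Open Scope group_scope.

(** * Polynomial sequences and the Hall-Petrescu formula *)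

Section PolynomialSequences.

Variable gT : finGroupType.
Implicit Types (g h u : nat -> gT) (i j k m n : nat).

Definition gdiff g n := g n.+1 * (g n)^-1.

Lemma eq_gdiff k g h : g =1 h -> iter k gdiff g =1 iter k gdiff h.
Proof.
by move=> eq_gh; elim: k => [|k IHk] n //=; rewrite /gdiff !IHk.
Qed.

Lemma gdiff_const1 k g : g =1 (fun=> 1) -> iter k gdiff g =1 (fun=> 1).
Proof. by move=> g1; elim: k => [|k IHk] n //=; rewrite /gdiff !IHk mulgV. Qed.

Variable F : nat -> {group gT}.
Hypothesis F_decr : forall i, F i.+1 \subset F i.
Hypothesis F_comm : forall i j, [~: F i, F j] \subset F (i + j).

Lemma F_leq i j : i <= j -> F j \subset F i.
Proof.
move=> /subnKC <-; elim: (j - i)%N => [|d IHd]; first by rewrite addn0.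
by rewrite addnS (subset_trans (F_decr _)).
Qed.

(* Leibman's polynomial sequences, for the filtration F (i + _). *)
Definition polyseq_in i g := forall k n, iter k gdiff g n \in F (i + k).

Lemma polyseq_inS i g :
  polyseq_in i g <-> (forall n, g n \in F i) /\ polyseq_in i.+1 (gdiff g).
Proof.
split=> [Pg|[Fg Pg] [|k] n]; last by rewrite iterSr addnS; exact: Pg.
  split=> [n|k n]; first by have:= Pg 0 n; rewrite addn0.
  by rewrite -iterSr addSnnS; exact: Pg.
by rewrite addn0; exact: Fg.
Qed.

Lemma polyseq_in_eq i g h : g =1 h -> polyseq_in i g -> polyseq_in i h.
Proof. by move=> eq_gh Pg k n; rewrite -(eq_gdiff k eq_gh). Qed.

Lemma polyseq_in_val i g n : polyseq_in i g -> g n \in F i.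
Proof. by case/polyseq_inS. Qed.

Lemma polyseq_in_diff i g : polyseq_in i g -> polyseq_in i.+1 (gdiff g).
Proof. by case/polyseq_inS. Qed.

Lemma polyseq_in_leq i j g : i <= j -> polyseq_in j g -> polyseq_in i g.
Proof.
move=> le_ij Pg k n; apply: (subsetP (F_leq _)) (Pg k n).
by rewrite leq_add2r.
Qed.

Lemma polyseq_in_shift i g : polyseq_in i g -> polyseq_in i (g \o succn).
Proof.
move=> Pg k n; suff -> : iter k gdiff (g \o succn) n = iter k gdiff g n.+1.
  exact: Pg.
by elim: k n => [|k IHk] n //=; rewrite /gdiff !IHk.
Qed.

Lemma polyseq_in_const1 i g : g =1 (fun=> 1) -> polyseq_in i g.
Proof. by move=> g1 k n; rewrite gdiff_const1. Qed.

(** By Pascal's rule the difference of [a ^+ 'C(n, m.+1)] is [a ^+ 'C(n, m)], which drives the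
    induction on [m]. *)
Lemma polyseq_in_bin i m a : a \in F (i + m) ->
  polyseq_in i (fun n => a ^+ 'C(n, m)).
Proof.
elim: m i => [|m IHm] i Fa; apply/polyseq_inS; split=> [n|].
- by rewrite bin0 -[i]addn0.
- by apply: polyseq_in_const1 => n; rewrite /gdiff !bin0 mulgV.
- by apply: groupX; apply: (subsetP (F_leq _)) Fa; apply: leq_addr.
have:= IHm i.+1; rewrite addSnnS => /(_ Fa); apply: polyseq_in_eq => n.
by rewrite /gdiff binS addnC expgnDr mulgK.
Qed.

(** Differences of inverses, products and commutators are expressed by the same operations at
    strictly deeper levels, so closure above level [m] gives closure from [m] on. *)
Lemma polyseq_inTrec m :
    (forall i g, m < i -> polyseq_in i g -> polyseq_in i (fun n => (g n)^-1)) ->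
    (forall i g h, m < i ->
       polyseq_in i g -> polyseq_in i h -> polyseq_in i (fun n => g n * h n)) ->
    (forall i j g h, m < i + j -> polyseq_in i g -> polyseq_in j h ->
       polyseq_in (i + j) (fun n => [~ g n, h n])) ->
  [/\ forall i g, m <= i -> polyseq_in i g -> polyseq_in i (fun n => (g n)^-1),
      forall i g h, m <= i ->
       polyseq_in i g -> polyseq_in i h -> polyseq_in i (fun n => g n * h n) &
      forall i j g h, m <= i + j -> polyseq_in i g -> polyseq_in j h ->
       polyseq_in (i + j) (fun n => [~ g n, h n])].
Proof.
move=> PV PM PR.
have PJ i u g : m < i -> polyseq_in i u -> polyseq_in 0 g ->
    polyseq_in i (fun n => u n ^ g n).
  move=> lt_mi Pu Pg.
  apply: polyseq_in_eq (fun n => esym (conjg_mulR (u n) (g n))) _.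
  apply: PM => //; rewrite -[i in polyseq_in i]addn0; apply: PR => //.
  by rewrite addn0.
have PV' i g : m <= i -> polyseq_in i g -> polyseq_in i (fun n => (g n)^-1).
  move=> le_mi Pg; apply/polyseq_inS; split=> [n|].
    by rewrite groupV polyseq_in_val.
  have Pd := PV _ _ (le_mi : m < i.+1) (polyseq_in_diff Pg).
  apply: polyseq_in_eq (PJ _ _ _ _ Pd (polyseq_in_leq (leq0n _) Pg)) => // n.
  by rewrite /gdiff invgK conjgE invMg invgK !mulgA mulVg mul1g.
have PM' i g h : m <= i -> polyseq_in i g -> polyseq_in i h ->
    polyseq_in i (fun n => g n * h n).
  move=> le_mi Pg Ph; apply/polyseq_inS; split=> [n|].
    by rewrite groupM ?polyseq_in_val.
  have Pg' := polyseq_in_leq (leq0n _) (PV' _ _ le_mi Pg).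
  have PhJ := PJ _ _ _ (le_mi : m < i.+1) (polyseq_in_diff Ph) Pg'.
  apply: polyseq_in_eq (PM _ _ _ (le_mi : m < i.+1) (polyseq_in_diff Pg) PhJ).
  by move=> n; rewrite /gdiff conjgE invgK invMg !mulgA mulgKV.
split=> // i j g h le_m Pg Ph.
set w := fun n => _.
pose a n := [~ gdiff g n, h n.+1] ^ g n.
pose b n := [~ g n, gdiff h n] ^ h n.
have lt_m : m < (i + j).+1 by [].
have P0 l u : polyseq_in l u -> polyseq_in 0 u by exact: polyseq_in_leq.
have Pa : polyseq_in (i + j).+1 a.
  apply: PJ (P0 _ _ Pg) => //; rewrite -addSn; apply: PR; rewrite ?addSn //.
    exact: polyseq_in_diff.
  exact: (polyseq_in_shift Ph).
have Pb : polyseq_in (i + j).+1 b.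
  apply: PJ (P0 _ _ Ph) => //; rewrite -addnS; apply: PR; rewrite ?addnS //.
  exact: polyseq_in_diff.
have wS n : w n.+1 = a n * w n * b n.
  rewrite /w /a /b /gdiff !commgEl !conjgE !invMg !invgK !mulgA.
  by rewrite mulVg mul1g !(mulgK, mulgKV).
(* The recurrence [wS] has the solution [al n * w 0 * (be n)^-1]. The differences of [al] and [be]
   are [a] and the inverse of [b], one level deeper than [w]. *)
pose al := fix al n := if n is n'.+1 then a n' * al n' else 1.
pose be := fix be n := if n is n'.+1 then (b n')^-1 * be n' else 1.
have Pal : polyseq_in (i + j) al.
  apply/polyseq_inS; split=> [n|].
    elim: n => [|n IHn] /=; first exact: group1.
    by rewrite groupM // (subsetP (F_decr _)) // polyseq_in_val.
  by apply: polyseq_in_eq Pa => n; rewrite /gdiff /= mulgK.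
have Pbe : polyseq_in (i + j) be.
  apply/polyseq_inS; split=> [n|].
    elim: n => [|n IHn] /=; first exact: group1.
    by rewrite groupM // groupV (subsetP (F_decr _)) // polyseq_in_val.
  by apply: polyseq_in_eq (PV _ _ lt_m Pb) => n; rewrite /gdiff /= mulgK.
have w0 : w 0 \in F (i + j + 0).
  by rewrite addn0 (subsetP (F_comm i j)) // mem_commg ?polyseq_in_val.
have Pw0 := polyseq_in_bin w0.
apply: polyseq_in_eq (PM' _ _ _ le_m (PM' _ _ _ le_m Pal Pw0) (PV' _ _ le_m Pbe)).
move=> n; rewrite bin0 expg1; elim: n => [|n IHn] /=.
  by rewrite mul1g invg1 mulg1.
by rewrite wS -IHn invMg invgK !mulgA.
Qed.

Hypothesis F_nil : exists c, F c :=: 1.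

(** The case [m = 0] is the Lazard-Leibman theorem that polynomial sequences form a group. The
    descent starts at a level where the filtration is trivial. *)
Lemma polyseq_inT m :
  [/\ forall i g, m <= i -> polyseq_in i g -> polyseq_in i (fun n => (g n)^-1),
      forall i g h, m <= i ->
       polyseq_in i g -> polyseq_in i h -> polyseq_in i (fun n => g n * h n) &
      forall i j g h, m <= i + j -> polyseq_in i g -> polyseq_in j h ->
       polyseq_in (i + j) (fun n => [~ g n, h n])].
Proof.
have [c Fc1] := F_nil; have F1 i x : c <= i -> x \in F i -> x = 1.
  by move=> /F_leq/subsetP sF /sF; rewrite Fc1 => /set1P.
have [d] : exists d, c <= m + d by exists c; exact: leq_addl.
elim: d m => [|d IHd] m; last first.
  by rewrite addnS -addSn => /IHd[]; exact: polyseq_inTrec.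
rewrite addn0 => le_cm; split=> [i g|i g h|i j g h] le_m.
- move=> /polyseq_in_val Fg; apply: polyseq_in_const1 => n.
  by rewrite (F1 _ _ (leq_trans le_cm le_m) (Fg n)) invg1.
- move=> /polyseq_in_val Fg /polyseq_in_val Fh; apply: polyseq_in_const1 => n.
  have le_ci := leq_trans le_cm le_m.
  by rewrite (F1 _ _ le_ci (Fg n)) (F1 _ _ le_ci (Fh n)) mulg1.
move=> /polyseq_in_val Fg /polyseq_in_val Fh; apply: polyseq_in_const1 => n.
apply: (F1 _ _ (leq_trans le_cm le_m)).
by rewrite (subsetP (F_comm i j)) // mem_commg.
Qed.

Lemma gdiff_prefix t r : (forall n, n < t -> r n = 1) -> iter t gdiff r 0 = r t.
Proof.
move=> r1.
suff D k : k <= t -> iter k gdiff r (t - k) = r t /\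
    forall n, n < t - k -> iter k gdiff r n = 1.
  by have [] := D t (leqnn t); rewrite subnn.
elim: k => [|k IHk] le_kt; first by rewrite subn0.
have [Dk Dk1] := IHk (ltnW le_kt).
have E : (t - k = (t - k.+1).+1)%N by rewrite -subSn.
split=> [|n lt_n] /=.
  by rewrite /gdiff -E Dk (Dk1 (t - k.+1)%N) ?E // invg1 mulg1.
by rewrite /gdiff !Dk1 ?mulgV // E ltnS ?(ltnW lt_n).
Qed.

(** Coefficients are peeled off one at a time: a remainder [r] that is trivial below [t] has [r t]
    as its [t]-th difference at 0, so [r t] lies in [F t] and is the next coefficient. *)
Lemma polyseq_taylor g t : polyseq_in 0 g ->
  exists2 c : nat -> gT, (forall m, c m \in F m) &
    forall n, n < t -> g n = \prod_(0 <= m < t) c m ^+ 'C(n, m).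
Proof.
move=> Pg; have [PV PM _] := polyseq_inT 0.
suff [c Fc [r [Pr r1 Dg]]] : exists2 c : nat -> gT, forall m, c m \in F m &
    exists r, [/\ polyseq_in 0 r, forall n, n < t -> r n = 1 &
      forall n, g n = (\prod_(0 <= m < t) c m ^+ 'C(n, m)) * r n].
  by exists c => // n lt_nt; rewrite Dg r1 // mulg1.
elim: t => [|t [c Fc [r [Pr r1 Dg]]]].
  exists (fun=> 1) => [m|]; first exact: group1.
  by exists g; split=> // n; rewrite big_nil mul1g.
have Frt : r t \in F (0 + t) by rewrite add0n -gdiff_prefix //; exact: Pr.
exists (fun m => if m == t then r t else c m) => [m|].
  by case: eqP => // ->.
exists (fun n => (r t ^+ 'C(n, t))^-1 * r n); split=> [|n|n].
- by apply: PM => //; apply: PV => //; exact: polyseq_in_bin.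
- rewrite ltnS leq_eqVlt => /predU1P[->|lt_nt]; last first.
    by rewrite bin_small // invg1 mul1g r1.
  by rewrite binn expg1 mulVg.
rewrite Dg big_nat_recr //= eqxx -mulgA mulKVg; congr (_ * _).
by apply: eq_big_nat => m /andP[_ lt_mt]; rewrite ltn_eqF.
Qed.

End PolynomialSequences.

(** The three subgroup lemma in the quotient by [L]. *)
Lemma three_subgroup_sub (gT : finGroupType) (G H K L : {group gT}) :
    G \subset 'N(L) -> H \subset 'N(L) -> K \subset 'N(L) ->
    [~: G, H, K] \subset L -> [~: H, K, G] \subset L ->
  [~: K, G, H] \subset L.
Proof.
move=> nG nH nK sGHK sHKG.
have R3 (A B C : {group gT}) : A \subset 'N(L) -> B \subset 'N(L) ->
    C \subset 'N(L) -> [~: A, B, C] / L = [~: A / L, B / L, C / L].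
  by move=> nA nB nC; rewrite !quotientR // comm_subG.
rewrite -quotient_sub1 ?comm_subG // R3 //; apply/trivgP.
have R1 (A B C : {group gT}) : A \subset 'N(L) -> B \subset 'N(L) ->
    C \subset 'N(L) -> [~: A, B, C] \subset L ->
    [~: A / L, B / L, C / L] = 1.
  by move=> nA nB nC sL; rewrite -R3 // quotientS1.
by apply: three_subgroup; exact: R1.
Qed.

Lemma lcn_comm (gT : finGroupType) (H : {group gT}) i j :
  [~: 'L_i.+1(H), 'L_j.+1(H)] \subset 'L_(i + j).+2(H).
Proof.
elim: j i => [|j IHj] i; first by rewrite addn0 lcn1 lcnSn.
have sN m n : 'L_m(H) \subset 'N('L_n(H)).
  exact: subset_trans (lcn_sub m H) (lcn_norm _ _).
rewrite (lcnSn j) commGC; apply: three_subgroup_sub; rewrite ?sN ?lcn_norm //.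
- rewrite (commGC H) -lcnSn; apply: subset_trans (IHj _) _.
  by rewrite addSnnS.
by rewrite addnS /= (lcnSn (i + j).+1) commSg.
Qed.

(** The sequence [(x * y) ^- k * (x ^+ k * y ^+ k)] is polynomial for the lower central filtration,
    and its Taylor expansion is the formula. *)
Lemma Hall_Petrescu (gT : finGroupType) (H : {group gT}) x y n :
    nilpotent H -> x \in H -> y \in H ->
  exists2 c : nat -> gT, (forall m, c m \in 'L_m(H)) &
    x ^+ n * y ^+ n =
      (x * y) ^+ n * \prod_(2 <= m < n.+1) c m ^+ 'C(n, m).
Proof.
(* Here [F 0] and [F 1] are both [H], so [z ^+ k], which is [z ^+ 'C(k, 1)], is polynomial of level
   0. *)
move=> nilH Hx Hy; pose F m := 'L_m(H)%G.
have F_decr i : F i.+1 \subset F i.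
  by case: i => [|i]; [exact: lcn_sub | exact: lcn_subS].
have F_comm i j : [~: F i, F j] \subset F (i + j).
  case: i j => [|i] [|j].
  - exact: (der_sub 1 H).
  - by rewrite add0n commGC; exact: (F_decr j.+1).
  - by rewrite addn0; exact: (F_decr i.+1).
  - by rewrite addSn addnS; exact: lcn_comm.
have F_nil : exists c, F c :=: 1.
  by have /lcnP[c Fc1] := nilH; exists c.+1.
have [PV PM _] := polyseq_inT F_decr F_comm F_nil 0.
have PX z : z \in H -> polyseq_in F 0 (fun n => z ^+ n).
  move=> Hz; apply: polyseq_in_eq (polyseq_in_bin F_decr (Hz : z \in F (0 + 1)%N)).
  by move=> k; rewrite bin1.
pose g k := (x * y) ^- k * (x ^+ k * y ^+ k).
have Pg : polyseq_in F 0 g.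
  apply: (PM) => //; last by apply: PM => //; exact: PX.
  by apply: PV => //; apply: PX; rewrite groupM.
(* With [n.+2] terms the expansion is valid at 0, 1 and [n] for every [n]; the trivial values [g 0]
   and [g 1] kill [c 0] and [c 1]. *)
have [c Fc Dg] := polyseq_taylor F_decr F_comm F_nil n.+2 Pg.
exists c => //; apply: (canRL (mulKVg _)); rewrite -/(g n) Dg ?leqnSn //.
have c0 : c 0 = 1.
  have:= Dg 0 isT; rewrite /g !expg0 big_nat_recl // big1 => [|m _].
    by rewrite bin0 expg1 !mulg1 invg1.
  by rewrite bin_small.
have c1 : c 1%N = 1.
  have:= Dg 1%N isT; rewrite /g !expg1 mulVg big_nat_recl // big_nat_recl //.
  rewrite big1 => [|m _]; last by rewrite bin_small.
  by rewrite c0 expg1n bin1 expg1 mul1g mulg1.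
rewrite big_nat_recr //= bin_small // expg0 mulg1.
case: n {Dg} => [|n]; first by rewrite big_nat1 big_geq // c0 expg1n.
by rewrite big_ltn // big_ltn // c0 c1 !expg1n !mul1g.
Qed.

(** * Powers and commutators in p-groups *)

(** Compare [p]-adic valuations in the identity [m * 'C(p ^ r, m) = p ^ r * 'C((p ^ r).-1,
    m.-1)]. *)
Lemma pfactor_dvd_bin p r m : prime p -> 0 < m ->
  p ^ (r - logn p m) %| 'C(p ^ r, m).
Proof.
case: m => // m p_pr _; have := mul_bin_diag (p ^ r) m.
have [->|C_gt0] := posnP 'C(p ^ r, m.+1); first by rewrite dvdn0.
move=> /(congr1 (dvdn (p ^ r))); rewrite dvdn_mulr // => /esym.
rewrite !pfactor_dvdn ?muln_gt0 // lognM // => le_r.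
by rewrite leq_subLR.
Qed.

Section PowersInPGroups.

Variable gT : finGroupType.
Implicit Types (N V W H R Q : {group gT}) (X Z : {set gT}).

Lemma expMg_coset p r H R x y :
    prime p -> nilpotent H -> x \in H -> y \in H ->
    (forall m u, 1 < m <= p ^ r -> u \in 'L_m(H) ->
       u ^+ (p ^ (r - logn p m)) \in R) ->
  (x * y) ^- (p ^ r) * (x ^+ (p ^ r) * y ^+ (p ^ r)) \in R.
Proof.
move=> p_pr nilH Hx Hy sR.
have [c Lc ->] := Hall_Petrescu (p ^ r) nilH Hx Hy.
rewrite mulKg big_nat; apply: group_prod => m; rewrite ltnS => m_bd.
have /dvdnP[q ->] := pfactor_dvd_bin r p_pr (ltnW (proj1 (andP m_bd))).
by rewrite mulnC expgM groupX ?sR.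
Qed.

Definition iter_commg V N i : {group gT} :=
  iter i (fun B : {group gT} => [~: B, N]%G) V.

Lemma iter_commgD V N i j :
  iter_commg V N (i + j) = iter_commg (iter_commg V N i) N j.
Proof. by rewrite addnC /iter_commg iterD. Qed.

Lemma iter_commg_normal V N i : V <| N -> iter_commg V N i <| N.
Proof.
move=> nsV; elim: i => //= i /andP[sN nN].
by rewrite /normal commg_normr (subset_trans _ sN) // commg_subl.
Qed.

Lemma iter_commgS V W N i : V \subset W -> iter_commg V N i \subset iter_commg W N i.
Proof. by move=> sVW; elim: i => //= i IHi; exact: commSg. Qed.

Lemma iter_commg_leq V N i j :
  V <| N -> i <= j -> iter_commg V N j \subset iter_commg V N i.
Proof.
move=> nsV /subnKC <-; elim: (j - i)%N => [|d IHd]; first by rewrite addn0.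
rewrite addnS (subset_trans _ IHd) //= commg_subl.
exact: normal_norm (iter_commg_normal _ nsV).
Qed.

Lemma lcn_sub_iter_commg V N i : V \subset N ->
  'L_i.+1(V) \subset iter_commg V N i.
Proof. by move=> sVN; elim: i => //= i IHi; rewrite lcnSn commgSS. Qed.

Lemma lcnE_iter_commg N i : 'L_i.+1(N) = iter_commg N N i.
Proof. by elim: i => //= i IHi; rewrite lcnSn IHi. Qed.

Lemma iter_commg_nil V N : nilpotent N -> V \subset N ->
  exists c, iter_commg V N c :=: 1.
Proof.
move=> /lcnP[c Lc1] sVN; exists c; apply/trivgP; rewrite -Lc1 lcnE_iter_commg.
exact: iter_commgS.
Qed.

Lemma commYg_sub V W N : V <| N -> W <| N ->
  [~: V <*> W, N] \subset [~: V, N] <*> [~: W, N].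
Proof.
move=> /andP[sVN nVN] /andP[sWN nWN].
rewrite norm_joinEr ?(subset_trans sWN) // commMG; last first.
  by rewrite (subset_trans sWN) // commg_normr.
by rewrite mulG_subG joing_subl joing_subr.
Qed.

(** Modulo [[V, N, N]] the group is generated by a cyclic group and a central one, hence abelian.
    This gains one commutator over [lcn_sub_iter_commg]. *)
Lemma lcn_cycle_commg V N z m : V <| N -> z \in V -> 1 < m ->
  'L_m(<[z]> <*> [~: V, N]) \subset iter_commg V N m.
Proof.
move=> nsVN Vz; have [sVN nVN] := andP nsVN.
have nsW := iter_commg_normal 1 nsVN; have nsD := iter_commg_normal 2 nsVN.
set H := _ <*> _; have sHV : H \subset V.
  by rewrite join_subG cycle_subG Vz commg_subl.
have sHN := subset_trans sHV sVN.
case: m => [|[|m]] // _; elim: m => [|m IHm]; last by rewrite lcnSn commgSS.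
rewrite lcn2; apply: der1_min; first exact: subset_trans sHN (normal_norm nsD).
have nD := normal_norm nsD; have sWN := normal_sub nsW.
have zN : <[z]> \subset N by rewrite cycle_subG (subsetP sVN).
rewrite quotientY ?(subset_trans _ nD) // abelianY.
rewrite quotient_abelian ?cycle_abelian //=; apply/andP; split.
  by apply: quotient_cents2r; rewrite commgS.
by rewrite centsC; apply: quotient_cents2r; rewrite commGC commgS.
Qed.

(** Since [[~ z, y]] is [z^-1 * z ^ y], this is [expMg_coset] inside the subgroup generated by [z]
    and [[V, N]]. *)
Lemma commXg_coset p r N V R z y :
    prime p -> nilpotent N -> V <| N -> z \in V -> y \in N ->
    (forall m u, 1 < m <= p ^ r -> u \in iter_commg V N m ->
       u ^+ (p ^ (r - logn p m)) \in R) ->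
  [~ z, y] ^- (p ^ r) * [~ z ^+ (p ^ r), y] \in R.
Proof.
move=> p_pr nilN nsVN Vz Ny sR; pose H := (<[z]> <*> [~: V, N])%G.
have sHN : H \subset N.
  rewrite join_subG cycle_subG (subsetP (normal_sub nsVN)) //=.
  exact: normal_sub (iter_commg_normal 1 nsVN).
have Hz : z \in H by rewrite mem_gen // inE cycle_id.
have Hzy : z ^ y \in H.
  by rewrite conjg_mulR groupM // mem_gen // inE mem_commg ?orbT.
have:= @expMg_coset p r H R z^-1 (z ^ y) p_pr (nilpotentS sHN nilN).
rewrite groupV -commgEl expVgn -conjXg -commgEl; apply=> // m u m_bd Lu.
by apply: sR => //; apply: subsetP (lcn_cycle_commg _ _ _) _ Lu => //; case/andP: m_bd.
Qed.

(** [S] need not be normal, so the subgroup [T] tests all conjugates of [x]: in [[x x', y] =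
    [x, y]^x' [x', y]] the first factor is [[x^x', y^x']]. *)
Lemma commg_gen_sub N X (S : {group gT}) : X \subset N -> N \subset 'N(X) ->
  {in X & N, forall x y, [~ x, y] \in S} -> [~: <<X>>, N] \subset S.
Proof.
move=> sXN nXN XS; pose T := [set x in N | [forall y in N, forall g in N,
  [~ x ^ g, y] \in S]].
have TP x : reflect (x \in N /\ {in N & N, forall y g, [~ x ^ g, y] \in S}) (x \in T).
  rewrite inE; apply: (iffP andP) => [[-> /forall_inP T_x]|[-> T_x]]; split=> //.
    by move=> y g Ny Ng; have /forall_inP-> := T_x y Ny.
  by apply/forall_inP=> y Ny; apply/forall_inP=> g Ng; exact: T_x.
have gT' : group_set T.
  apply/group_setP; split=> [|x x' /TP[Nx Tx] /TP[Nx' Tx']].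
    by apply/TP; split=> [|y g _ _]; rewrite ?group1 // conj1g comm1g group1.
  apply/TP; split=> [|y g Ny Ng]; first exact: groupM.
  have Nx'g : x' ^ g \in N by exact: groupJ.
  rewrite conjMg commMgJ groupM //; last exact: Tx'.
  by rewrite conjRg -conjgM Tx // ?(groupJ Ny) ?(groupM Ng).
have sXT : <<X>> \subset Group gT'.
  rewrite gen_subG; apply/subsetP=> x Xx; apply/TP; split=> [|y g Ny Ng].
    exact: (subsetP sXN).
  by apply: XS => //; rewrite memJ_norm // (subsetP nXN).
rewrite gen_subG; apply/subsetP=> _ /imset2P[x y /(subsetP sXT)/TP[_ Tx] Ny ->].
by rewrite -[x]conjg1 Tx.
Qed.

Lemma gen_normal N X : X \subset N -> N \subset 'N(X) -> <<X>> <| N.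
Proof. by move=> sXN nXN; rewrite /normal gen_subG sXN norms_gen. Qed.

(** By [expMg_coset] the [u] with [u ^+ (p ^ r)] in [R] form a subgroup, so only the generators
    [[~ z, y]] matter; [commXg_coset] treats those. *)
Lemma expg_commg_gen p r N Z R :
    prime p -> nilpotent N -> Z \subset N -> N \subset 'N(Z) ->
    {in Z & N, forall z y, [~ z ^+ (p ^ r), y] \in R} ->
    (forall m u, 1 < m <= p ^ r -> u \in iter_commg <<Z>> N m ->
       u ^+ (p ^ (r - logn p m)) \in R) ->
  {in [~: <<Z>>, N], forall u, u ^+ (p ^ r) \in R}.
Proof.
move=> p_pr nilN sZN nZN RZ sR; have nsV := gen_normal sZN nZN.
pose W := [~: <<Z>>, N]%G; have nsW := iter_commg_normal 1 nsV.
pose T := [set u in W | u ^+ (p ^ r) \in R].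
have gT' : group_set T.
  apply/group_setP; split=> [|u v]; first by rewrite inE group1 expg1n group1.
  rewrite !inE => /andP[Wu Ru] /andP[Wv Rv]; rewrite groupM //=.
  rewrite -groupV -(groupMr _ (groupM Ru Rv)); apply: expMg_coset Wu Wv _ => //.
    exact: nilpotentS (normal_sub nsW) nilN.
  move=> [|m] // x m_bd Lx; apply: sR => //.
  rewrite -add1n iter_commgD; apply: subsetP Lx.
  exact: lcn_sub_iter_commg (normal_sub nsW).
suff /subsetP sWT : W \subset Group gT' by move=> u /sWT; rewrite inE => /andP[].
apply: commg_gen_sub => // z y Zz Ny; rewrite inE /= mem_commg ?mem_gen //=.
rewrite -groupV -(groupMr _ (RZ z y Zz Ny)).
by apply: commXg_coset sR => //; rewrite mem_gen.
Qed.

(* With M_i = [U, N, ..., N] (i copies of N), one shows that u ^ (p ^ r) is in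
   R M_j for u in M_i, by increasing j and, for fixed j, decreasing i: the
   generators [z, y] of M_i satisfy [z, y] ^ (p ^ r) = [z ^ (p ^ r), y] up to
   powers of elements of M_(i+1), and z ^ (p ^ r) is in R M_(j-1). *)
Lemma expg_commg p r N X R :
    prime p -> nilpotent N -> X \subset N -> N \subset 'N(X) -> R <| N ->
    {in X & N, forall x y, [~ x ^+ (p ^ r), y] \in R} ->
    (forall j u, 0 < j <= r -> u \in iter_commg [~: <<X>>, N] N (p ^ j).-1 ->
       u ^+ (p ^ (r - j)) \in R) ->
  {in [~: <<X>>, N], forall u, u ^+ (p ^ r) \in R}.
Proof.
move=> p_pr nilN sXN nXN nsR RX sR; have nsV := gen_normal sXN nXN.
pose U := [~: <<X>>, N]%G; pose M i := iter_commg U N i.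
have nsU : U <| N := iter_commg_normal 1 nsV.
have nsM i : M i <| N by exact: iter_commg_normal.
have M_leq i j : i <= j -> M j \subset M i by exact: iter_commg_leq.
have [c Mc1] := iter_commg_nil nilN (normal_sub nsU).
suff S j i : {in M i, forall u, u ^+ (p ^ r) \in R <*> M j}.
  by move=> u Uu; have:= S c 0 u Uu; rewrite Mc1 joingG1.
elim: j i => [|j IHj] i.
  move=> u /(subsetP (M_leq _ _ (leq0n i))) Mu.
  by rewrite groupX // mem_gen // inE Mu orbT.
have [d] : exists d, j < i + d by exists j.+1; rewrite leq_addl.
elim: d i => [|d IHd] i.
  rewrite addn0 => /M_leq/subsetP sM u /sM Mu.
  by rewrite groupX // mem_gen // inE Mu orbT.
rewrite addnS -addSn => /IHd{}IHd.
(* If [p] does not divide [m], then [u] lies in a deeper [M] and [IHd] applies; otherwise [m] is at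
   least [p ^ logn p m] and [sR] applies. *)
have Err m u : 1 < m <= p ^ r -> u \in M (i + m.-1)%N ->
    u ^+ (p ^ (r - logn p m)) \in R <*> M j.+1.
  move=> /andP[m_gt1 le_mr] Mu; have m_gt0 := ltnW m_gt1.
  have [lm0|lm_gt0] := posnP (logn p m).
    rewrite lm0 subn0; apply: IHd; apply: subsetP Mu; apply: M_leq.
    by rewrite -addn1 leq_add2l -subn1 subn_gt0.
  have le_pm : p ^ logn p m <= m by rewrite dvdn_leq // pfactor_dvdnn.
  rewrite (subsetP (joing_subl _ _)) // sR ?lm_gt0 //=.
    by rewrite -(leq_exp2l _ _ (prime_gt1 p_pr)) (leq_trans le_pm).
  apply: subsetP Mu; apply: M_leq; apply: leq_trans (leq_addl _ _).
  by rewrite -!subn1 leq_sub2r.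
case: i => [|i] in IHd Err *.
  apply: expg_commg_gen => // [x y Xx Ny|[//|m] u m_bd Vu].
    by rewrite (subsetP (joing_subl _ _)) ?RX.
  by apply: Err => //; rewrite -add1n iter_commgD in Vu.
have EM : M i :=: <<M i>> by rewrite genGid.
rewrite /M /= -/(M i) EM; apply: expg_commg_gen => //.
- exact: normal_sub.
- exact: normal_norm.
- move=> z y Mz Ny; have Rz := IHj i z Mz.
  have: [~ z ^+ (p ^ r), y] \in [~: R <*> M j, N] by rewrite mem_commg.
  move/(subsetP (commYg_sub nsR (nsM j))); apply: subsetP.
  by rewrite join_subG joing_subr (subset_trans _ (joing_subl _ _)) // commg_subl normal_norm.
move=> [//|m] u m_bd; rewrite (_ : iter_commg _ _ _ = M (i + m.+1)%N).
  by rewrite -addSnnS => Mu; exact: Err.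
by rewrite /M iter_commgD; congr iter_commg; apply: val_inj; rewrite /= genGid.
Qed.

Definition power_group m V : {group gT} := <<[set x ^+ m | x in V]>>%G.

Lemma power_groupS m V W : V \subset W -> power_group m V \subset power_group m W.
Proof. by move=> sVW; apply/genS/imsetS. Qed.

Lemma mem_power_group m V x : x \in V -> x ^+ m \in power_group m V.
Proof. by move=> Vx; apply/mem_gen/imset_f. Qed.

Lemma power_set_norm m N X : N \subset 'N(X) -> N \subset 'N([set x ^+ m | x in X]).
Proof.
move=> nXN; apply/subsetP=> y Ny; rewrite inE.
apply/subsetP=> _ /imsetP[_ /imsetP[x Xx ->] ->].
by rewrite conjXg; apply: imset_f; rewrite memJ_norm // (subsetP nXN).
Qed.

Lemma power_set_sub m N X : X \subset N -> [set x ^+ m | x in X] \subset N.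
Proof.
by move=> sXN; apply/subsetP=> _ /imsetP[x Xx ->]; rewrite groupX ?(subsetP sXN).
Qed.

Lemma power_group_normal m N V : V <| N -> power_group m V <| N.
Proof.
case/andP=> sVN nVN; apply: gen_normal; first exact: power_set_sub.
exact: power_set_norm.
Qed.

(** Collection with [r = 1]: weights below [p] contribute [p]-th powers from [[V, N]], and weight
    [p] contributes an element of the iterated commutator. *)
Lemma commg_power_group p N V : prime p -> nilpotent N -> V <| N ->
  [~: power_group p V, N] \subset power_group p [~: V, N] <*> iter_commg V N p.
Proof.
move=> p_pr nilN nsVN; have [sVN nVN] := andP nsVN.
pose R := (power_group p [~: V, N] <*> iter_commg V N p)%G.
apply: (@commg_gen_sub _ _ R); rewrite ?power_set_sub ?power_set_norm //.
move=> _ y /imsetP[x Vx ->] Ny.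
have Rxy : [~ x, y] ^+ p \in R.
  by rewrite (subsetP (joing_subl _ _)) // mem_power_group // mem_commg.
rewrite -(groupMl _ (groupVr Rxy)).
have:= @commXg_coset p 1 N V R x y p_pr nilN nsVN Vx Ny.
rewrite expn1; apply=> m u /andP[m_gt1].
rewrite leq_eqVlt => /predU1P[-> Vu|lt_mp Vu].
  by rewrite (logn_prime p p_pr) eqxx groupX // (subsetP (joing_subr _ _)).
have ->: logn p m = 0%N.
  apply/eqP; rewrite -leqn0 leqNgt -(pfactor_dvdn 1) ?(ltnW m_gt1) //.
  by rewrite expn1 gtnNdvd ?(ltnW m_gt1).
rewrite expn1 (subsetP (joing_subl _ _)) // mem_power_group //.
exact: subsetP (iter_commg_leq nsVN (ltnW m_gt1)) _ Vu.
Qed.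

Lemma sub_power_commg (p : nat) N Q R : p.-group N -> Q <| N -> R <| N ->
  Q \subset R <*> (power_group p Q <*> [~: Q, N]) -> Q \subset R.
Proof.
move=> pN nsQ nsR sQ; have nilN := pgroup_nil pN.
have [[sQN nQN] [sRN nRN]] := (andP nsQ, andP nsR).
have sQ' : Q \subset R <*> [~: Q, N].
  have sDQ : [~: Q, N] \subset Q by rewrite commg_subl.
  pose P := (Q <*> R)%G; pose D := (R <*> [~: Q, N])%G.
  have sPN : P \subset N by rewrite join_subG sQN.
  have pP := pgroupS sPN pN.
  have sDP : D \subset P by rewrite join_subG joing_subr (subset_trans sDQ) ?joing_subl.
  suff EP : D :=: P by rewrite -/(gval D) EP joing_subl.
  rewrite -[D :=: P]/(gval D = P) -[LHS]genGid; apply: Phi_nongen.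
  apply/eqP; rewrite eqEsubset join_subG Phi_sub sDP /= join_subG.
  rewrite (subset_trans (joing_subl R [~: Q, N])) ?joing_subr // andbT.
  apply: subset_trans sQ _; rewrite !join_subG.
  rewrite (subset_trans (joing_subl R [~: Q, N])) ?joing_subr //=.
  rewrite (subset_trans (joing_subr R [~: Q, N])) ?joing_subr // andbT.
  rewrite gen_subG; apply/subsetP=> _ /imsetP[x Qx ->].
  rewrite mem_gen // inE (Phi_joing pP) mem_gen // inE.
  have Px : x \in P by rewrite mem_gen // inE Qx.
  by rewrite -[p]expn1 Mho_p_elt ?orbT // (mem_p_elt pP).
have [c Qc1] := iter_commg_nil nilN sQN.
suff: Q \subset R <*> iter_commg Q N c by rewrite Qc1 joingG1.
elim: c {Qc1} => [|c IHc]; first exact: joing_subr.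
apply: subset_trans sQ' _; rewrite join_subG joing_subl /=.
apply: subset_trans (commSg _ IHc) _.
apply: subset_trans (commYg_sub nsR (iter_commg_normal _ nsQ)) _.
by rewrite join_subG joing_subr (subset_trans _ (joing_subl _ _)) // commg_subl.
Qed.

End PowersInPGroups.

(** * The tower of commutator layers *)

Lemma leq_mul_pred_expn p j : 0 < p -> j * p.-1 <= (p ^ j).-1.
Proof.
move=> p_gt0; elim: j => // j IHj; rewrite expnS.
have: 0 < p ^ j by rewrite expn_gt0 p_gt0.
nia.
Qed.

Section CommutatorTower.

Variables (gT : finGroupType) (p : nat) (N : {group gT}) (X : {set gT}).
Hypotheses (p_pr : prime p) (pN : p.-group N).
Hypotheses (sXN : X \subset N) (nXN : N \subset 'N(X)).

Definition power_layer k : {group gT} := <<[set x ^+ (p ^ k) | x in X]>>%G.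
Definition comm_layer k : {group gT} := [~: power_layer k, N]%G.

Local Notation P := power_layer.
Local Notation U := comm_layer.

Let nilN : nilpotent N. Proof. exact: pgroup_nil pN. Qed.

Lemma power_layer_normal k : P k <| N.
Proof. by apply: gen_normal; [exact: power_set_sub | exact: power_set_norm]. Qed.

Lemma comm_layer_normal k : U k <| N.
Proof. exact: (iter_commg_normal 1 (power_layer_normal k)). Qed.

Lemma power_layerS k : P k.+1 \subset power_group p (P k).
Proof.
rewrite gen_subG; apply/subsetP=> _ /imsetP[x Xx ->].
rewrite expnSr expgM mem_power_group // mem_gen //.
exact: (imset_f (fun x => x ^+ _)).
Qed.

Lemma comm_layer_leq k l : k <= l -> U l \subset U k.
Proof.
move=> /subnKC <-; elim: (l - k)%N => [|d IHd]; first by rewrite addn0.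
rewrite addnS; apply: subset_trans IHd; apply: commSg.
apply: subset_trans (power_layerS _) _; rewrite gen_subG.
exact: power_set_sub.
Qed.

(** Repeated use of [commg_power_group]. At [i = 0] its error term has [p] commutations of [P k]
    with [N], that is [p.-1] of [U k]. *)
Lemma comm_layer_iterS k i :
  iter_commg (U k.+1) N i \subset
    power_group p (iter_commg (U k) N i) <*> iter_commg (U k) N (p.-1 + i).
Proof.
have nsU := comm_layer_normal k.
have Dp : p = p.-1.+1 by rewrite prednK // prime_gt0.
elim: i => [|i IHi] /=.
  apply: subset_trans (commSg _ (power_layerS k)) _.
  apply: subset_trans (commg_power_group p_pr nilN (power_layer_normal k)) _.
  by rewrite {2}Dp addn0 -add1n iter_commgD.
apply: subset_trans (commSg _ IHi) _.
have nsL := iter_commg_normal i nsU.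
apply: subset_trans (commYg_sub (power_group_normal p nsL)
  (iter_commg_normal (p.-1 + i) nsU)) _.
rewrite join_subG addnS joing_subr andbT.
apply: subset_trans (commg_power_group p_pr nilN nsL) _.
by rewrite join_subG joing_subl -iter_commgD {1}Dp addnS addnC joing_subr.
Qed.

Lemma comm_layer_power k :
  power_group p (U k) \subset U k.+1 <*> iter_commg (U k) N p.-1.
Proof.
have nsU := comm_layer_normal.
pose R := (U k.+1 <*> iter_commg (U k) N p.-1)%G.
have nsR : R <| N.
  rewrite /normal join_subG (normal_sub (nsU _)).
  rewrite (normal_sub (iter_commg_normal _ (nsU _))) normsY //.
    exact: normal_norm.
  by apply: normal_norm; apply: iter_commg_normal.
suff pU : {in U k, forall u, u ^+ (p ^ 1) \in R}.
  by rewrite gen_subG; apply/subsetP=> _ /imsetP[u /pU Ru ->].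
apply: expg_commg => //; rewrite ?power_set_sub ?power_set_norm //.
  move=> _ y /imsetP[x Xx ->] Ny; rewrite (subsetP (joing_subl _ _)) //.
  rewrite -expgM -expnD addn1 mem_commg // mem_gen //.
  exact: (imset_f (fun x => x ^+ _)).
move=> j u; case: j => [|[|j]] //= _; rewrite expn1 => Uu.
by rewrite expg1 (subsetP (joing_subr _ _)).
Qed.

(** By [sub_power_commg] it is enough to work modulo [M ^ p [M, N]]. The two preceding lemmas then
    leave only [U (k + s)] commuted [p.-1] times with [N]. *)
Lemma comm_layer_tower d s :
    p = d.+2 /\ s = 1%N \/ [/\ p = 2, d = 1%N & s = 2] ->
    iter_commg (U 0) N d \subset U s ->
  forall k, iter_commg (U k) N d \subset U (k + s).
Proof.
move=> ds U0; elim=> // k IHk; have nsU := comm_layer_normal.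
apply: (sub_power_commg pN (iter_commg_normal _ (nsU _)) (nsU _)).
set M := iter_commg _ N d; set R := U _ <*> _.
have sR1 : U (k.+1 + s) \subset R by exact: joing_subl.
have sR2 : power_group p M \subset R.
  by rewrite (subset_trans _ (joing_subr _ _)) // joing_subl.
have sR3 : [~: M, N] \subset R.
  by rewrite (subset_trans _ (joing_subr _ _)) // joing_subr.
suff sR4 : iter_commg (U (k + s)) N p.-1 \subset R.
  apply: subset_trans (comm_layer_iterS _ _) _; rewrite join_subG.
  rewrite (subset_trans (power_groupS _ IHk)) /=; last first.
    by apply: subset_trans (comm_layer_power _) _; rewrite join_subG sR4 -addSn sR1.
  by rewrite addnC iter_commgD (subset_trans (iter_commgS _ _ IHk)).
(* For [s = 1] the remaining group is [[M, N]] itself. For [p = 2] one more use of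
   [comm_layer_iterS] puts [[U (k + 2), N]] inside [M ^ 2 [M, N]]. *)
case: ds => [[-> ->]|[p2 d1 ->]]; first by rewrite addn1.
have p1 : p.-1 = 1%N by rewrite p2.
move: sR2 sR3; rewrite /M d1 p1 addn2 => sR2 sR3.
apply: subset_trans (comm_layer_iterS _ _) _.
by rewrite join_subG sR2 p1.
Qed.

Lemma comm_layer_iter d : (forall k, iter_commg (U k) N d \subset U k.+1) ->
  forall k j i, j * d <= i -> iter_commg (U k) N i \subset U (k + j).
Proof.
move=> dU k j i; elim: j i => [|j IHj] i le_i.
  by rewrite addn0; apply: iter_commg_leq (comm_layer_normal k) (leq0n i).
have ->: i = (j * d + d + (i - j.+1 * d))%N by lia.
have nsU := comm_layer_normal.
rewrite -addnA iter_commgD; apply: subset_trans (iter_commgS _ _ (IHj _ (leqnn _))) _.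
apply: subset_trans (iter_commg_leq (nsU _) (leq_addr _ _)) _.
by rewrite addnS.
Qed.

(** Descending induction on [k], the layers from [e] on being trivial. The correction terms lie in
    [U (k + j)] because [j * p.-1 <= (p ^ j).-1]. *)
Lemma comm_layer_exponent e :
    (forall k, iter_commg (U k) N p.-1 \subset U k.+1) ->
    {in X, forall x, x ^+ (p ^ e) = 1} ->
  forall k, {in U k, forall u, u ^+ (p ^ (e - k)) = 1}.
Proof.
move=> pU Xe k; have [d] : exists d, e <= k + d by exists e; rewrite leq_addl.
elim: d k => [|d IHd] k.
  rewrite addn0 => le_ek u; suff ->: U k :=: 1 by move=> /set1P->; rewrite expg1n.
  apply/trivgP; apply: commg_gen_sub; rewrite ?power_set_sub ?power_set_norm //.
  move=> _ y /imsetP[x Xx ->] _; rewrite -(subnKC le_ek) expnD expgM Xe //.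
  by rewrite expg1n comm1g group1.
rewrite addnS -addSn => le_ek u Uu; apply/set1P.
apply: (expg_commg p_pr nilN _ _ (normal1 _)) Uu; rewrite ?power_set_sub ?power_set_norm //.
  move=> _ y /imsetP[x Xx ->] _; rewrite -expgM -expnD.
  apply/set1P; have /subnKC <- : e <= k + (e - k) by lia.
  by rewrite expnD expgM Xe // expg1n comm1g.
move=> j v /andP[j_gt0 le_j] Uv; apply/set1P; rewrite -subnDA.
apply: IHd; first by lia.
apply: subsetP (comm_layer_iter pU _ _) _ Uv.
exact/leq_mul_pred_expn/prime_gt0.
Qed.

(** By collection the elements killed by [p ^ r] form a subgroup. The bound [p ^ j - 2] arises
    because ['L_m(N)] is [U 0] commuted [m - 2] times with [N], and [m] is at least [p ^ j] when [j]
    is its valuation. *)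
Lemma gen_exponent r :
    N :=: <<X>> -> {in X, forall x, x ^+ (p ^ r) = 1} ->
    {in U 0, forall u, u ^+ (p ^ r) = 1} ->
    (forall j u, 0 < j <= r -> u \in iter_commg (U 0) N (p ^ j - 2) ->
       u ^+ (p ^ (r - j)) = 1) ->
  {in N, forall x, x ^+ (p ^ r) = 1}.
Proof.
move=> defN Xr U0r Ujr.
have U0 : U 0 = [~: N, N]%G.
  apply: val_inj; rewrite /= {2}defN; congr [~: <<_>>, _].
  by apply/setP=> x; apply/imsetP/idP=> [[y Xy ->]|Xx]; [|exists x].
pose T := [set x in N | x ^+ (p ^ r) == 1].
have gT' : group_set T.
  apply/group_setP; split=> [|x y]; first by rewrite inE group1 expg1n eqxx.
  rewrite !inE => /andP[Nx /eqP xr] /andP[Ny /eqP yr]; rewrite groupM //=.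
  suff /set1P : (x * y) ^- (p ^ r) * (x ^+ (p ^ r) * y ^+ (p ^ r)) \in 1%G.
    by rewrite xr yr !mulg1 -invg_eq1 => ->.
  apply: expMg_coset Nx Ny _ => // m u /andP[m_gt1 le_m] Lu.
  have m_gt0 := ltnW m_gt1; apply/set1P.
  have Uu i : i.+2 <= m -> u \in iter_commg (U 0) N i.
    move=> le_im; rewrite U0 -(iter_commgD N N 1 i) -lcnE_iter_commg add1n.
    exact: subsetP (lcn_sub_leq _ le_im) _ Lu.
  have [lm0|lm_gt0] := posnP (logn p m).
    by rewrite lm0 subn0; exact: U0r (Uu 0 m_gt1).
  have le_pm : p ^ logn p m <= m by rewrite dvdn_leq // pfactor_dvdnn.
  apply: Ujr; last first.
    apply: Uu; have := prime_gt1 p_pr; have : p ^ 1 <= p ^ logn p m.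
      by rewrite leq_exp2l // prime_gt1.
    by rewrite expn1; lia.
  by rewrite lm_gt0 -(leq_exp2l _ _ (prime_gt1 p_pr)) (leq_trans le_pm).
suff /subsetP sNT : N \subset Group gT' by move=> x /sNT; rewrite inE => /andP[_ /eqP].
rewrite {1}defN gen_subG; apply/subsetP=> x Xx.
by rewrite inE (subsetP sXN) //= Xr.
Qed.

(** The extra factor [p] shifts [j] by one, so that [j * p.-1 <= p ^ j.+1 - 2] suffices. *)
Lemma exponent_gen_bound e :
    N :=: <<X>> -> {in X, forall x, x ^+ (p ^ e) = 1} ->
    (forall k, iter_commg (U k) N p.-1 \subset U k.+1) ->
  {in N, forall x, x ^+ (p ^ e.+1) = 1}.
Proof.
move=> defN Xe pU; have Ue := comm_layer_exponent pU Xe.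
apply: gen_exponent => // [x Xx|u Uu|j u].
- by rewrite expnSr expgM Xe // expg1n.
- by have:= Ue 0 u Uu; rewrite subn0 expnSr expgM => ->; rewrite expg1n.
case: j => // j /andP[_ le_je] Uu; rewrite subSS.
apply: Ue; rewrite -[j]add0n; apply: subsetP (comm_layer_iter pU _ _) _ Uu.
by have := leq_mul_pred_expn j.+1 (prime_gt0 p_pr); have := prime_gt1 p_pr; nia.
Qed.

(** Descending a layer every [p - 2] commutators needs only [j * (p - 2) <= p ^ j - 2], true for all
    [j > 0], so no factor [p] is lost. *)
Lemma exponent_gen_eq e :
    N :=: <<X>> -> {in X, forall x, x ^+ (p ^ e) = 1} ->
    (forall k, iter_commg (U k) N (p - 2) \subset U k.+1) ->
  {in N, forall x, x ^+ (p ^ e) = 1}.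
Proof.
move=> defN Xe pU.
have pU1 k : iter_commg (U k) N p.-1 \subset U k.+1.
  rewrite (subset_trans _ (pU k)) // iter_commg_leq ?comm_layer_normal //.
  by have := prime_gt1 p_pr; lia.
have Ue := comm_layer_exponent pU1 Xe.
apply: gen_exponent => // [u Uu|j u /andP[j_gt0 _] Uu].
  by have:= Ue 0 u Uu; rewrite subn0.
apply: Ue; rewrite -[j]add0n; apply: subsetP (comm_layer_iter pU _ _) _ Uu.
by have := leq_mul_pred_expn j (prime_gt0 p_pr); have := prime_gt1 p_pr; nia.
Qed.

End CommutatorTower.

(** * Commutator calculus in nu(G) *)

(** Stated for arbitrary maps, it covers the two copies of [G] in [nu G] as well as the pairs of
    endomorphisms of [G] that define homomorphisms out of [nu G]. *)
Definition nu_relations (G N : groupType) (i j : G -> N) :=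
  forall a b c, [~ i a, j b] ^ i c = [~ i (a ^ c), j (b ^ c)] /\
                [~ i a, j b] ^ j c = [~ i (a ^ c), j (b ^ c)].

Section NuRelations.

Variables (G N : groupType) (i j : UMagmaMorphism.type G N).
Hypothesis rel : nu_relations i j.

Lemma nu_relations_sym : nu_relations j i.
Proof.
move=> a b c; have [relI relJ] := rel b a c.
by rewrite -invgR !conjVg relI relJ invgR.
Qed.

Lemma nu_conj_l a b c : [~ i a, j b] ^ i c = [~ i (a ^ c), j (b ^ c)].
Proof. by case: (rel a b c). Qed.

Lemma nu_conj_r a b c : [~ i a, j b] ^ j c = [~ i (a ^ c), j (b ^ c)].
Proof. by case: (rel a b c). Qed.

Let nu_conj := (nu_conj_l, nu_conj_r).

Lemma conj_commE (T : groupType) (x g h : T) :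
  x ^ [~ g, h] = (((x ^ g^-1) ^ h^-1) ^ g) ^ h.
Proof. by rewrite -!conjgM commgEl conjgE !mulgA. Qed.

Lemma nu_conj_comm a b g h :
  [~ i a, j b] ^ [~ i g, j h] = [~ i (a ^ [~ g, h]), j (b ^ [~ g, h])].
Proof. by rewrite !conj_commE -!gmulfV !nu_conj. Qed.

(** Conjugation by [j y] multiplies [i x] by [[~ i x, j y]], and both copies of [G] act alike on
    such commutators. *)
Lemma nu_conj_comm_l k g h : i k ^ [~ i g, j h] = i k ^ j [~ g, h].
Proof.
have jE x y : i x ^ j y = i x * [~ i x, j y] by rewrite commgEl mulKVg.
rewrite conj_commE -!gmulfV -(gmulfJ i) jE (conjMg _ _ (i g)) (conjMg _ _ (j h)).
rewrite -(gmulfJ i) !nu_conj.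
rewrite conjgKV (commgEr g h) [in RHS]gmulfM conjgM [in RHS]jE.
by rewrite (conjMg _ _ (j h)) nu_conj.
Qed.

Lemma nu_conj_comm_r k g h : j k ^ [~ i g, j h] = j k ^ i [~ g, h].
Proof.
have iE x y : j x ^ i y = j x * [~ j x, i y] by rewrite commgEl mulKVg.
have nu_conj' a b c : ([~ j a, i b] ^ i c = [~ j (a ^ c), i (b ^ c)]) *
                     ([~ j a, i b] ^ j c = [~ j (a ^ c), i (b ^ c)]).
  by have [] := nu_relations_sym a b c.
rewrite conj_commE -!gmulfV iE (conjMg _ _ (j h^-1)) (conjMg _ _ (i g)) !nu_conj'.
rewrite -(gmulfJ j) iE 2!(conjMg _ _ (j h)) !nu_conj'.
rewrite -(gmulfJ j) conjgKV (commgEl g h) [in RHS]gmulfM conjgM [in RHS]iE.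
rewrite (conjMg _ _ (i (g ^ h))) nu_conj' iE.
by rewrite -!conjgM -!mulgA -!conjgE.
Qed.

(** Expanding both sides as [(j k)^-1] conjugated, times [j k], leaves only the action of
    [[~ i g, j h]] on the second copy. *)
Lemma nu_commA_r g h k : [~ i g, j h, j k] = [~ i [~ g, h], j k].
Proof.
by rewrite [LHS]commgEr [RHS]commgEr !conjVg nu_conj_comm_r.
Qed.

Lemma nu_commA_l g h k : [~ i g, j h, i k] = [~ i [~ g, h], j k].
Proof.
by rewrite -nu_commA_r [LHS]commgEl [RHS]commgEl nu_conj_l nu_conj_r.
Qed.

End NuRelations.

(** * The lower central series of nu(G) *)

Section LowerCentralSeries.

Variable gT : finGroupType.
Implicit Types (N D : {group gT}).

Lemma commg_closed_r N D (S : {set gT}) z : D <| N -> z \in N -> S \subset N ->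
    (forall s, s \in S -> [~ z, s] \in D) ->
  {in <<S>>, forall y, [~ z, y] \in D}.
Proof.
move=> /andP[_ nDN] Nz sSN zS; pose T := [set y in N | [~ z, y] \in D].
have gT' : group_set T.
  apply/group_setP; split=> [|x y]; first by rewrite inE !group1 commg1 group1.
  rewrite !inE => /andP[Nx Dx] /andP[Ny Dy]; rewrite groupM //= commgMJ groupM //.
  by rewrite memJ_norm // (subsetP nDN).
suff /subsetP sST : <<S>> \subset Group gT' by move=> y /sST; rewrite inE => /andP[].
rewrite gen_subG; apply/subsetP=> s Ss.
by rewrite inE (subsetP sSN) //= zS.
Qed.

(** For [D] normal in [N], this is the preimage in [N] of the centre of [N / D]. *)
Definition commg_closed_set N D := [set z in N | [forall y in N, [~ z, y] \in D]].

Lemma commg_closed_setP N D z :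
  reflect (z \in N /\ {in N, forall y, [~ z, y] \in D}) (z \in commg_closed_set N D).
Proof. by rewrite inE; apply: (iffP andP) => -[Nz /forall_inP zD]. Qed.

Lemma commg_closed_group_set N D : D <| N -> group_set (commg_closed_set N D).
Proof.
case/andP=> _ nDN; apply/group_setP; split=> [|x y].
  by apply/commg_closed_setP; split=> // y _; rewrite comm1g group1.
case/commg_closed_setP=> Nx Dx /commg_closed_setP[Ny Dy].
apply/commg_closed_setP; split=> [|z Nz]; first exact: groupM.
by rewrite commMgJ groupM ?Dy // memJ_norm ?Dx // (subsetP nDN).
Qed.

Lemma commg_closed_normal N D (nsDN : D <| N) :
  Group (commg_closed_group_set nsDN) <| N.
Proof.
have [_ nDN] := andP nsDN; apply/andP; split.
  by apply/subsetP=> z /commg_closed_setP[].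
apply/subsetP=> y Ny; rewrite inE; apply/subsetP=> _ /imsetP[z /commg_closed_setP[Nz Dz] ->].
apply/commg_closed_setP; split=> [|x Nx]; first exact: groupJ.
rewrite -[x](conjgKV y) -conjRg memJ_norm ?(subsetP nDN) // Dz //.
by rewrite groupJ ?groupV.
Qed.

End LowerCentralSeries.

Section NuLowerCentral.

Variables (G K : finGroupType).
Implicit Types i j : UMagmaMorphism.type G K.

(** Let [E] be the preimage of the centre of [K / D]. It contains [i [~ g, x]] by hypothesis, and
    [[~ i g, j x]] because its commutator with [i y] or [j y] is [[~ i [~ g, x], j y]]. *)
Lemma commg_lcn_image i j n (D : {group K}) :
    nu_relations i j -> <<(i @: [set: G]) :|: (j @: [set: G])>> = [set: K] ->
    D <| [set: K] -> [~: i @: 'L_n.+1([set: G]), [set: K]] \subset D ->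
  [~: i @: 'L_n([set: G]), [set: K], [set: K]] \subset D.
Proof.
move=> rel genK nsD sLD; have nsE := commg_closed_normal nsD.
set E := Group _ in nsE.
have EP z : {in [set: K], forall y, [~ z, y] \in D} -> z \in E.
  by move=> zD; apply/commg_closed_setP; split=> //; rewrite inE.
have L_E g x : g \in 'L_n([set: G]) -> i [~ g, x] \in E.
  move=> Lg; apply: EP => y _; apply: (subsetP sLD); rewrite mem_commg ?inE //.
  by apply/imset_f/(subsetP (lcnSnS _ _)); rewrite mem_commg ?inE.
have L_Ej g x : g \in 'L_n([set: G]) -> [~ i g, j x] \in E.
  move=> Lg; apply: EP; rewrite -genK.
  apply: (commg_closed_r nsD); rewrite ?inE ?subsetT // => s.
  have /commg_closed_setP[_ LD] := L_E g x Lg.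
  by case/setUP=> /imsetP[y _ ->]; rewrite ?(nu_commA_l rel) ?(nu_commA_r rel) LD ?inE.
have sE : [~: i @: 'L_n([set: G]), [set: K]] \subset E.
  rewrite gen_subG; apply/subsetP=> _ /imset2P[_ y /imsetP[g Lg ->] _ ->].
  move: y; suff: {in [set: K], forall y, [~ i g, y] \in E} by move=> gE y; rewrite gE ?inE.
  rewrite -genK; apply: (commg_closed_r nsE); rewrite ?inE ?subsetT // => s.
  by case/setUP=> /imsetP[x _ ->]; [rewrite -gmulfR L_E | exact: L_Ej].
rewrite gen_subG; apply/subsetP=> _ /imset2P[z y /(subsetP sE) Ez Ky ->].
have [_ zD] := commg_closed_setP _ _ _ Ez.
exact: zD.
Qed.

Lemma nu_lcn i j n :
    nu_relations i j -> <<(i @: [set: G]) :|: (j @: [set: G])>> = [set: K] ->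
  'L_n.+2([set: K]) \subset
    [~: i @: 'L_n.+1([set: G]), [set: K]] <*> [~: j @: 'L_n.+1([set: G]), [set: K]].
Proof.
move=> rel genK; pose A f m := [~: f @: 'L_m([set: G]), [set: K]]%G.
have nsA f m : A f m <| [set: K] by rewrite /normal subsetT commg_normr.
have nsC f h m : (A f m <*> A h m)%G <| [set: K].
  by rewrite /normal subsetT normsY // normal_norm.
elim: n => [|n IHn].
  pose C := (A i 1%N <*> A j 1%N)%G; have nsC1 : C <| [set: K] by exact: nsC.
  suff /subsetP sTE : [set: K] \subset Group (commg_closed_group_set nsC1).
    rewrite gen_subG; apply/subsetP=> _ /imset2P[x y Kx Ky ->].
    by have /commg_closed_setP[_ ->] := sTE x Kx.
  rewrite -{1}genK gen_subG; apply/subsetP=> _ /setUP[] /imsetP[g Gg ->];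
    apply/commg_closed_setP; split=> [|y _]; rewrite ?inE // mem_gen // inE.
    by rewrite mem_commg ?inE ?imset_f.
  by rewrite orbC mem_commg ?inE ?imset_f.
rewrite lcnSn; apply: subset_trans (commSg _ IHn) _.
apply: subset_trans (commYg_sub (nsA i n.+1) (nsA j n.+1)) _.
rewrite join_subG; apply/andP; split.
  by apply: (commg_lcn_image rel genK (nsC i j n.+2)); exact: joing_subl.
rewrite setUC in genK.
by apply: (commg_lcn_image (nu_relations_sym rel) genK (nsC i j n.+2)); exact: joing_subr.
Qed.

End NuLowerCentral.

(** * Exponent and potency of finite groups satisfying the relations *)

Section FiniteNu.

Variables (p e : nat) (G K : finGroupType) (i j : UMagmaMorphism.type G K).
Hypotheses (p_pr : prime p) (pK : p.-group [set: K]).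
Hypothesis expG : forall g : G, g ^+ (p ^ e) = 1.
Hypothesis rel : nu_relations i j.
Hypothesis genK : <<(i @: [set: G]) :|: (j @: [set: G])>> = [set: K].

Definition nu_gens : {set K} :=
  class_support ((i @: [set: G]) :|: (j @: [set: G])) [set: K].

Let nX : [set: K] \subset 'N(nu_gens).
Proof. exact: class_support_norm. Qed.

Let sub_nu_gens : (i @: [set: G]) :|: (j @: [set: G]) \subset nu_gens.
Proof. exact: sub_class_support. Qed.

Lemma nu_gens_gen : [set: K] = <<nu_gens>>.
Proof. by apply/eqP; rewrite eqEsubset subsetT andbT -{1}genK genS. Qed.

Lemma nu_gens_exponent : {in nu_gens, forall x, x ^+ (p ^ e) = 1}.
Proof.
move=> _ /imset2P[_ y /setUP[]/imsetP[g _ ->] _ ->];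
by rewrite -conjXg -gmulfXn expG gmulf1 conj1g.
Qed.

Local Notation U := (comm_layer p [set: K] nu_gens).

Lemma lcn_image_sub_layer (f : UMagmaMorphism.type G K) n s :
    f @: [set: G] \subset nu_gens ->
    'L_n([set: G]) \subset power_subgroup (p ^ s) [set: G] ->
  [~: f @: 'L_n([set: G]), [set: K]] \subset U s.
Proof.
move=> sfX sL; apply: commSg; apply/subsetP=> _ /imsetP[g Lg ->].
pose T := [set g | f g \in power_layer p nu_gens s].
have gT : group_set T.
  apply/group_setP; split=> [|x y]; first by rewrite inE gmulf1 group1.
  by rewrite !inE gmulfM => /groupM; apply.
suff: 'L_n([set: G]) \subset Group gT by move/subsetP/(_ g Lg); rewrite inE.
apply: subset_trans sL _; rewrite gen_subG; apply/subsetP=> _ /imsetP[h _ ->].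
rewrite inE gmulfXn mem_gen //; apply: (imset_f (fun x => x ^+ _)).
by rewrite (subsetP sfX) ?imset_f ?inE.
Qed.

Lemma lcn_sub_layer n s :
    'L_n.+1([set: G]) \subset power_subgroup (p ^ s) [set: G] ->
  'L_n.+2([set: K]) \subset U s.
Proof.
move=> sL; apply: subset_trans (nu_lcn n rel genK) _.
by rewrite join_subG !lcn_image_sub_layer // (subset_trans _ sub_nu_gens) ?subsetUl ?subsetUr.
Qed.

Lemma comm_layer0E d : iter_commg (U 0) [set: K] d = 'L_d.+2([set: K]) :> {set K}.
Proof.
rewrite lcnE_iter_commg -add1n iter_commgD; congr (gval (iter_commg _ _ _)).
apply: val_inj; rewrite /= [X in _ = [~: X, _]]nu_gens_gen; congr [~: <<_>>, _].
by apply/setP=> x; apply/imsetP/idP=> [[y Xy ->]|Xx]; [|exists x].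
Qed.

Lemma nu_exponent_odd : odd p ->
    'L_(p.-1)([set: G]) \subset power_subgroup p [set: G] ->
  forall x : K, x ^+ (p ^ e) = 1.
Proof.
move=> p_odd sL x; have p_gt2 := odd_prime_gt2 p_odd p_pr.
have pU : forall k, iter_commg (U k) [set: K]%G (p - 2) \subset U k.+1.
  move=> k; rewrite -[k.+1]addn1; apply: (comm_layer_tower p_pr pK (subsetT _) nX).
    by left; split=> //; lia.
  (* The hypothesis on ['L_(p.-1)] of [G] becomes: ['L_p] of [K] lies in [U 1], one commutator being
     spent on passing from [G] to [K]. *)
  rewrite comm_layer0E (_ : (p - 2).+2 = (p - 2).-1.+3)%N; last by lia.
  apply: lcn_sub_layer; rewrite expn1.
  by rewrite (_ : (p - 2).-1.+2 = p.-1)%N //; lia.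
apply: (exponent_gen_eq p_pr pK (subsetT _) nX nu_gens_gen nu_gens_exponent pU).
by rewrite inE.
Qed.

Lemma nu_exponent_even : p = 2 ->
    [set: G]^`(1) \subset power_subgroup 4 [set: G] ->
  forall x : K, x ^+ (p ^ e.+1) = 1.
Proof.
move=> p2 sL x.
have p1 : p.-1 = 1%N by rewrite p2.
have pU : forall k, iter_commg (U k) [set: K]%G p.-1 \subset U k.+1.
  move=> k; rewrite p1.
  apply: subset_trans (comm_layer_leq _ _ _ (leqnSn k.+1)).
  rewrite -[k.+2]addn2; apply: (comm_layer_tower p_pr pK (subsetT _) nX); first by right.
  (* Here [d = 1] and [s = 2]: the inclusion of ['L_2] of [G] in the fourth powers puts ['L_3] of
     [K] inside [U 2]. *)
  by rewrite comm_layer0E; apply: lcn_sub_layer; rewrite p2 lcn2.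
apply: (exponent_gen_bound p_pr pK (subsetT _) nX nu_gens_gen nu_gens_exponent pU).
by rewrite inE.
Qed.

(** ['L_p.-1] of [K] lies in [U 1], which lies in the normal subgroup generated by [p]-th powers of
    elements of [nu_gens]. *)
Lemma nu_potent : odd p ->
    'L_(p - 2)([set: G]) \subset power_subgroup p [set: G] ->
  potent_pgroup p [set: K].
Proof.
move=> p_odd sL; have p_gt2 := odd_prime_gt2 p_odd p_pr.
rewrite /potent_pgroup pK /= ifF; last by lia.
rewrite (_ : p.-1 = (p - 3).+2)%N; last by lia.
apply: (@subset_trans _ _ (U 1)).
  apply: lcn_sub_layer; rewrite expn1.
  by rewrite (_ : (p - 3).+1 = (p - 2))%N //; lia.
apply: subset_trans (_ : power_layer p nu_gens 1 \subset _).
  by rewrite commg_subl normal_norm // power_layer_normal // ?subsetT.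
rewrite gen_subG; apply/subsetP=> _ /imsetP[x _ ->].
by rewrite expn1 mem_gen //; apply: (imset_f (fun x => x ^+ _)); rewrite inE.
Qed.

End FiniteNu.

(** * Central extensions of finite groups by torsion *)

Section CentralProducts.

Variable N : groupType.

Definition central (z : N) := forall x, commute z x.

Lemma perm_prod_central (I : eqType) (r1 r2 : seq I) (F : I -> N) :
    (forall i, i \in r1 -> central (F i)) -> perm_eq r1 r2 ->
  \prod_(i <- r1) F i = \prod_(i <- r2) F i.
Proof.
elim: r1 r2 => [|a r1 IHr1] r2; first by rewrite perm_sym => _ /perm_nilP->.
move=> cF eq_r; have r2a : a \in r2 by rewrite -(perm_mem eq_r) mem_head.
case/splitPr: r2a eq_r => s1 s2; rewrite perm_sym perm_catC cat_cons perm_cons => eq_r.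
rewrite big_cons (IHr1 (s1 ++ s2)) => [|i r1i|]; last 2 first.
- by apply: cF; rewrite inE r1i orbT.
- by rewrite perm_sym perm_catC.
by rewrite !big_cat /= big_cons !mulgA (cF a (mem_head _ _)).
Qed.

(** For central [w] with [w ^+ M = 1] and [M > 0], this enumerates, possibly with repetitions, the
    finite abelian group generated by [W]. *)
Fixpoint torsion_span (M : nat) (W : seq N) : seq N :=
  if W is w :: W' then [seq w ^+ a * z | a <- iota 0 M, z <- torsion_span M W']
  else [:: 1].

Lemma torsion_span1 M W : 0 < M -> 1 \in torsion_span M W.
Proof.
move=> M_gt0; elim: W => [|w W IHW] /=; first exact: mem_head.
by apply/allpairsP; exists (0, 1); split; rewrite ?mem_iota //= mul1g.
Qed.

Lemma expg_modn (x : N) M a : x ^+ M = 1 -> x ^+ (a %% M) = x ^+ a.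
Proof.
by move=> xM; rewrite {2}(divn_eq a M) expgnDr mulnC expgnA xM expg1n mul1g.
Qed.

Lemma torsion_span_mul M W w z : 0 < M -> (forall v, v \in W -> central v) ->
    (forall v, v \in W -> v ^+ M = 1) ->
  w \in W -> z \in torsion_span M W -> w * z \in torsion_span M W.
Proof.
move=> M_gt0; elim: W z => // v W IHW z cW WM.
rewrite inE => Ww /allpairsP[[a y] /= [a_in Wy ->]].
have [->|Wnv] := eqVneq w v.
  rewrite mulgA -expgS -(expg_modn a.+1 (WM v (mem_head _ _))).
  by apply/allpairsP; exists (a.+1 %% M, y); split; rewrite ?mem_iota ?ltn_pmod.
rewrite (negPf Wnv) /= in Ww.
have cw : central w by apply: cW; rewrite inE Ww orbT.
rewrite mulgA (cw (v ^+ a)) -mulgA; apply/allpairsP; exists (a, w * y); split=> //=.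
by apply: IHW => // u Wu; [apply: cW | apply: WM]; rewrite inE Wu orbT.
Qed.

End CentralProducts.

Section CentralExtension.

Variables (N : groupType) (Q : finGroupType) (f : UMagmaMorphism.type N Q).
Variables (gen : seq N) (m : nat).
Hypothesis central_ker : forall z, f z = 1 -> central z.
Hypothesis gen_ind : forall P : N -> Prop, P 1 ->
  (forall x l, l \in gen -> P x -> P (x * l)) -> forall x, P x.
Hypothesis gen_torsion : forall l, l \in gen -> l ^+ m = 1.
Hypothesis m_gt0 : 0 < m.

Definition morph_range : {set Q} := [set q | `[< exists x, f x = q >]].

Lemma mem_morph_range x : f x \in morph_range.
Proof. by rewrite inE; apply/asboolP; exists x. Qed.

Lemma morph_range_group_set : group_set morph_range.
Proof.
apply/group_setP; split=> [|q r]; first by rewrite -(gmulf1 (s := f)) mem_morph_range.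
rewrite !inE => /asboolP[x <-] /asboolP[y <-].
by rewrite -gmulfM; apply/asboolP; exists (x * y).
Qed.

Let E := Group morph_range_group_set.

Lemma morph_section : {s : Q -> N & forall q, q \in E -> f (s q) = q}.
Proof.
apply: (choice (P := fun q y => q \in E -> f y = q)) => q.
have [Eq|] := boolP (q \in E); last by exists 1.
by move: (Eq); rewrite inE => /asboolP[x fx]; exists x.
Qed.

Let s := projT1 morph_section.
Let fs q : q \in E -> f (s q) = q. Proof. exact: (projT2 morph_section). Qed.

(** The Schreier elements of the section [s]; they lie in the kernel and satisfy the cocycle
    identity [cocM]. *)
Let coc q x := s q * x * (s (q * f x))^-1.

Let coc_ker q x : q \in E -> f (coc q x) = 1.
Proof.
move=> Eq; rewrite !gmulfM gmulfV !fs ?mulgV //.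
by rewrite groupM // mem_morph_range.
Qed.

Let cocM q x y : coc q (x * y) = coc q x * coc (q * f x) y.
Proof. by rewrite /coc gmulfM !mulgA mulgKV. Qed.

(* The transfer of N into the central kernel of f. *)
Let V x := \prod_(q <- enum E) coc q x.

Let V_ker x : f (V x) = 1.
Proof.
rewrite gmulf_prod big_seq big1 // => q; rewrite mem_enum; exact: coc_ker.
Qed.

Let VM x y : V (x * y) = V x * V y.
Proof.
have c_coc q z : q \in E -> central (coc q z) by move=> Eq; exact/central_ker/coc_ker.
rewrite /V (eq_bigr _ (fun q _ => cocM q x y)).
rewrite [LHS]big_seq prodgM_commute => [|q r Eq Er]; last first.
  by apply: c_coc; rewrite mem_enum in Eq.
rewrite -!big_seq; congr (_ * _).
(* Right translation by [f x] permutes [E], and the factors are central, so the second product is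
   [V y]. *)
rewrite -(big_map (fun q => q * f x) predT (fun q => coc q y)).
apply: perm_prod_central => [q /mapP[r]|].
  by rewrite mem_enum => Er ->; apply: c_coc; rewrite groupM ?mem_morph_range.
apply: uniq_perm; rewrite ?map_inj_uniq ?enum_uniq //; first exact: mulIg.
move=> q; rewrite mem_enum; apply/mapP/idP=> [[r]|Eq].
  by rewrite mem_enum => Er ->; rewrite groupM ?mem_morph_range.
exists (q * (f x)^-1); last by rewrite mulgKV.
by rewrite mem_enum groupM ?groupV ?mem_morph_range.
Qed.

Let V_central z : f z = 1 -> V z = z ^+ #|E|.
Proof.
move=> fz; rewrite /V (eq_bigr (fun=> z)) => [|q _].
  by rewrite big_const_seq count_predT -cardE iter_mulg_1.
by rewrite /coc fz mulg1 -(central_ker fz) mulgK.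
Qed.

Let VX x n : V (x ^+ n) = V x ^+ n.
Proof.
have V1 : V 1 = 1 by rewrite V_central ?gmulf1 // expg1n.
by elim: n => [|n IHn]; rewrite ?V1 // !expgS VM IHn.
Qed.

Let V_torsion x : V x ^+ m = 1.
Proof.
elim/gen_ind: x => [|x l gen_l Vx]; first by rewrite -VX expg1n V_central ?gmulf1 // expg1n.
rewrite VM expgMn ?Vx; last exact: central_ker.
by rewrite mul1g -VX gen_torsion // V_central ?gmulf1 // expg1n.
Qed.

(** On the kernel the transfer is the [#|E|]-th power, and its values have order dividing [m]
    because those at the generators do. *)
Lemma central_ker_torsion z : f z = 1 -> z ^+ (#|E| * m) = 1.
Proof. by move=> fz; rewrite expgnA -V_central // V_torsion. Qed.

Lemma central_ext_torsion (x : N) : x ^+ (#|E| * (#|E| * m)) = 1.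
Proof.
rewrite expgnA central_ker_torsion // gmulfXn.
by apply/eqP; rewrite -order_dvdn order_dvdG ?mem_morph_range.
Qed.

(** Schreier's argument: [z * s q * l] equals [z * coc q l * s (q * f l)], so the list is stable
    under right multiplication by generators. *)
Lemma central_ext_finite : {r : seq N | forall x, x \in r}.
Proof.
pose M := (#|E| * m)%N; have M_gt0 : 0 < M by rewrite muln_gt0 cardG_gt0.
(* The element [(s 1)^-1] is added because the section need not send 1 to 1. *)
pose W := (s 1)^-1 :: [seq coc q l | q <- enum E, l <- gen].
have W_ker w : w \in W -> f w = 1.
  rewrite inE => /predU1P[->|/allpairsP[[q l] /= [Eq _ ->]]].
    by rewrite gmulfV fs ?invg1 ?group1.
  by rewrite coc_ker // -mem_enum.
have W_central w : w \in W -> central w by move/W_ker; exact: central_ker.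
have W_torsion w : w \in W -> w ^+ M = 1 by move/W_ker; exact: central_ker_torsion.
exists [seq z * s q | z <- torsion_span M W, q <- enum E] => x.
elim/gen_ind: x => [|x l gen_l /allpairsP[[z q] /= [Wz Eq ->]]].
  have W1 : (s 1)^-1 * 1 \in torsion_span M W.
    by apply: torsion_span_mul; rewrite ?mem_head ?torsion_span1.
  apply/allpairsP; exists ((s 1)^-1 * 1, 1); split; rewrite ?mem_enum ?group1 //.
  by rewrite mulg1 mulVg.
rewrite mem_enum in Eq.
have Wc : coc q l \in W by rewrite inE allpairs_f ?mem_enum ?orbT.
apply/allpairsP; exists (coc q l * z, q * f l); split.
- exact: (torsion_span_mul M_gt0 W_central W_torsion Wc Wz).
- by rewrite /= mem_enum (groupM (G := E)) ?mem_morph_range.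
by rewrite /= (W_central _ Wc z) /coc -[RHS]mulgA mulgVK mulgA.
Qed.

End CentralExtension.

(** * Finiteness of nu(G) *)

(** An alias carrying the enumeration, on which a finite structure is put without changing the group
    law; the identity is then an isomorphism with [N]. *)
Definition finite_copy (N : groupType) (r : seq N) (rP : forall x, x \in r) : Type := N.

Section FiniteCopy.

Variables (N : groupType) (r : seq N) (rP : forall x, x \in r).

HB.instance Definition _ := Group.on (finite_copy rP).

Let index_in (x : finite_copy rP) : seq_sub r := SeqSub (rP x).
Let index_inK : cancel index_in (fun u => val u : finite_copy rP).
Proof. by []. Qed.

HB.instance Definition _ := Choice_isCountable.Build (finite_copy rP)
  (pcan_pickleK (can_pcan index_inK)).

HB.instance Definition _ : isFinite (finite_copy rP) := CanIsFinite index_inK.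

End FiniteCopy.

(** * Universal property of nu(G) and the central kernel *)

Section NuUniversal.

Local Open Scope quotient_scope.

Variable G : groupType.

Definition nu_l (g : G) : nu G := \pi_(nu G) [:: inl g].
Definition nu_r (g : G) : nu G := \pi_(nu G) [:: inr g].

Lemma nu_piM u v : \pi_(nu G) (u ++ v) = \pi_(nu G) u * \pi_(nu G) v.
Proof. exact/esym/nu_mul_pi. Qed.

Lemma nu_lM : {morph nu_l : x y / x * y}.
Proof. by move=> x y; rewrite -nu_piM; apply/esym/nu_piP; exact: nu_eq_Ml. Qed.

Lemma nu_rM : {morph nu_r : x y / x * y}.
Proof. by move=> x y; rewrite -nu_piM; apply/esym/nu_piP; exact: nu_eq_Mr. Qed.

Lemma nu_l1 : nu_l 1 = 1. Proof. by apply/nu_piP; exact: nu_eq_1l. Qed.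
Lemma nu_r1 : nu_r 1 = 1. Proof. by apply/nu_piP; exact: nu_eq_1r. Qed.

HB.instance Definition _ := isUMagmaMorphism.Build G (nu G) nu_l (nu_l1, nu_lM).
HB.instance Definition _ := isUMagmaMorphism.Build G (nu G) nu_r (nu_r1, nu_rM).

Lemma nu_ind (P : nu G -> Prop) :
    P 1 -> (forall x g, P x -> P (x * nu_l g)) ->
    (forall x g, P x -> P (x * nu_r g)) ->
  forall x, P x.
Proof.
move=> P1 Pl Pr x; rewrite -[x]reprK; elim/last_ind: (repr x) => // w l Pw.
by rewrite -cats1 nu_piM; case: l => g; [apply: Pl | apply: Pr].
Qed.

Section Words.

Variables (H : groupType) (a b : UMagmaMorphism.type G H).
Hypothesis rel : nu_relations a b.

Definition letter_eval (l : G + G) : H :=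
  match l with inl g => a g | inr g => b g end.

Definition word_eval (w : seq (G + G)) := \prod_(l <- w) letter_eval l.

Lemma word_eval_cat u v : word_eval (u ++ v) = word_eval u * word_eval v.
Proof. exact: big_cat. Qed.

Lemma word_eval1 l : word_eval [:: l] = letter_eval l.
Proof. exact: big_seq1. Qed.

Lemma word_eval_inv w : word_eval (word_inv w) = (word_eval w)^-1.
Proof.
elim: w => [|l w IHw]; first by rewrite /word_eval big_nil invg1.
rewrite -[l :: w]cat1s [in RHS]word_eval_cat /word_inv map_cons rev_cons -cats1.
rewrite word_eval_cat IHw invMg !word_eval1; congr (_ * _).
by case: l => g; rewrite /= gmulfV.
Qed.

Lemma nu_eq_word_eval u v : nu_eq u v -> word_eval u = word_eval v.
Proof.
have commE x y : word_eval (word_comm [:: inl x] [:: inr y]) = [~ a x, b y].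
  rewrite /word_comm !word_eval_cat !word_eval_inv !word_eval1.
  by rewrite commgEl conjgE.
elim=> {u v} //.
- by move=> u v w _ -> _ ->.
- by move=> u u' v v' _ Eu _ Ev; rewrite !word_eval_cat Eu Ev.
- by rewrite word_eval1 /word_eval big_nil /= gmulf1.
- by rewrite word_eval1 /word_eval big_nil /= gmulf1.
- by move=> x y; rewrite -cat1s word_eval_cat !word_eval1 /= gmulfM.
- by move=> x y; rewrite -cat1s word_eval_cat !word_eval1 /= gmulfM.
- move=> x y c; rewrite /word_conj 2!word_eval_cat word_eval_inv word_eval1 !commE.
  by rewrite -conjgE (nu_conj_l rel).
move=> x y c; rewrite /word_conj 2!word_eval_cat word_eval_inv word_eval1 !commE.
by rewrite -conjgE (nu_conj_r rel).
Qed.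

(** The proof of the relations is an argument so that the morphism structure can be attached to the
    term [nu_lift rel]. *)
Definition nu_lift of nu_relations a b := fun x : nu G => word_eval (repr x).

Lemma nu_lift_pi w : nu_lift rel (\pi_(nu G) w) = word_eval w.
Proof. exact/nu_eq_word_eval/nu_repr. Qed.

Lemma nu_liftM : {morph nu_lift rel : x y / x * y}.
Proof.
move=> x y; rewrite -[x]reprK -[y]reprK -nu_piM !nu_lift_pi.
exact: word_eval_cat.
Qed.

Lemma nu_lift1 : nu_lift rel 1 = 1.
Proof. by rewrite [LHS](nu_lift_pi [::]) /word_eval big_nil. Qed.

HB.instance Definition _ :=
  isUMagmaMorphism.Build (nu G) H (nu_lift rel) (nu_lift1, nu_liftM).

Lemma nu_lift_l g : nu_lift rel (nu_l g) = a g.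
Proof. by rewrite nu_lift_pi word_eval1. Qed.

Lemma nu_lift_r g : nu_lift rel (nu_r g) = b g.
Proof. by rewrite nu_lift_pi word_eval1. Qed.

End Words.

Lemma nu_lr_relations : nu_relations nu_l nu_r.
Proof.
have pi_inv w : \pi_(nu G) (word_inv w) = (\pi_(nu G) w)^-1.
  apply/esym/mulg1_eq; rewrite -nu_piM -{1}[w]word_invK.
  by apply/nu_piP; exact: nu_eq_wordV.
have commE x y : \pi_(nu G) (word_comm [:: inl x] [:: inr y]) = [~ nu_l x, nu_r y].
  by rewrite /word_comm !nu_piM !pi_inv commgEl conjgE.
have conjE u v : \pi_(nu G) (word_conj u v) = \pi_(nu G) u ^ \pi_(nu G) v.
  by rewrite /word_conj !nu_piM pi_inv conjgE.
move=> x y c; rewrite -!commE -[nu_l c]/(\pi_(nu G) [:: inl c]).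
rewrite -[nu_r c]/(\pi_(nu G) [:: inr c]) -!conjE.
by split; apply/nu_piP; [exact: nu_eq_Jl | apply/nu_eq_sym/nu_eq_Jr].
Qed.

Definition idmorph : UMagmaMorphism.type G G := idfun.
Definition triv : UMagmaMorphism.type G G := @one_fun G G.

Lemma nu_relations_id : nu_relations idmorph idmorph.
Proof. by move=> x y c; rewrite /= conjRg. Qed.

Lemma nu_relations_id1 : nu_relations idmorph triv.
Proof. by move=> x y c; rewrite /= !commg1 !conj1g. Qed.

Lemma nu_relations_1id : nu_relations triv idmorph.
Proof. exact: nu_relations_sym nu_relations_id1. Qed.

Local Notation i := (nu_l : UMagmaMorphism.type G (nu G)).
Local Notation j := (nu_r : UMagmaMorphism.type G (nu G)).
Local Notation pi1 := (nu_lift nu_relations_id1).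
Local Notation pi2 := (nu_lift nu_relations_1id).
Local Notation pi3 := (nu_lift nu_relations_id).
Let rel := nu_lr_relations.
Let nu_conj := (nu_conj_l rel, nu_conj_r rel).

(* The properties of the elements of [G, G^phi] from which the kernel of
   nu(G) -> G x G x G is seen to be central. *)
Record tensor_like (t : nu G) : Prop := TensorLike {
  tensor_r : forall k, j k ^ t = j k ^ i (pi3 t);
  tensor_l : forall k, i k ^ t = i k ^ j (pi3 t);
  tensor_c : forall g h, [~ i g, j h] ^ t = [~ i g, j h] ^ i (pi3 t);
  tensor_1 : pi1 t = 1;
  tensor_2 : pi2 t = 1
}.

Let iE x y : i x ^ j y = i x * [~ i x, j y]. Proof. by rewrite commgEl mulKVg. Qed.
Let jE x y : j x ^ i y = j x * [~ i y, j x]^-1.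
Proof. by rewrite invgR commgEl mulKVg. Qed.

Lemma tensor_like1 : tensor_like 1.
Proof. by split=> *; rewrite !gmulf1 ?conjg1. Qed.

Lemma tensor_likeM t u : tensor_like t -> tensor_like u -> tensor_like (t * u).
Proof.
move=> [tr tl tc t1 t2] [ur ul uc u1 u2]; split=> [k|k|g h||].
- rewrite nu_liftM gmulfM (conjgM _ t) tr conjgM jE (conjMg _ _ u) conjVg uc ur.
  by rewrite -conjVg -conjMg.
- rewrite nu_liftM gmulfM (conjgM _ t) tl conjgM iE (conjMg _ _ u) uc ul.
  by rewrite nu_conj -(nu_conj_r rel) -conjMg.
- by rewrite nu_liftM gmulfM (conjgM _ t) tc conjgM !nu_conj uc !nu_conj.
- by rewrite nu_liftM t1 u1 mulg1.
by rewrite nu_liftM t2 u2 mulg1.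
Qed.

Let pi3V t : pi3 t^-1 = (pi3 t)^-1. Proof. exact: gmulfV. Qed.

Lemma tensor_likeV t : tensor_like t -> tensor_like t^-1.
Proof.
move=> [tr tl tc t1 t2].
have tcV g h : [~ i g, j h] ^ t^-1 = [~ i g, j h] ^ i (pi3 t^-1).
  apply: (@conjg_inj _ t); rewrite conjgKV pi3V nu_conj tc nu_conj.
  by rewrite -!conjgM mulVg !conjg1.
split=> // [k|k||].
- apply: (@conjg_inj _ t); rewrite conjgKV jE (conjMg _ _ t) conjVg tc tr.
  by rewrite -conjVg -conjMg -jE pi3V gmulfV conjgKV.
- apply: (@conjg_inj _ t); rewrite conjgKV iE (conjMg _ _ t) tc tl.
  by rewrite nu_conj -(nu_conj_r rel) -conjMg -iE pi3V gmulfV conjgKV.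
- by rewrite [LHS]gmulfV [X in X^-1]t1 invg1.
by rewrite [LHS]gmulfV [X in X^-1]t2 invg1.
Qed.

Lemma tensor_like_comm a b : tensor_like [~ i a, j b].
Proof.
have E3 : pi3 [~ i a, j b] = [~ a, b].
  by rewrite [LHS]gmulfR; congr [~ _, _]; [exact: nu_lift_l | exact: nu_lift_r].
split=> [k|k|g h||].
- by rewrite E3 (nu_conj_comm_r rel).
- by rewrite E3 (nu_conj_comm_l rel).
- by rewrite E3 (nu_conj_comm rel) nu_conj.
- rewrite [LHS]gmulfR; rewrite [X in [~ _, X]](nu_lift_r nu_relations_id1).
  exact: commg1.
rewrite [LHS]gmulfR; rewrite [X in [~ X, _]](nu_lift_l nu_relations_1id).
exact: comm1g.
Qed.

(** Moving [j g] to the left of [i a] creates [[~ i a, j g]], whose conjugates by both copies are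
    again commutators of this form. *)
Lemma nu_decomp x : exists a b t, tensor_like t /\ x = t * j b * i a.
Proof.
elim/nu_ind: x => [|x g [a [b [t [Tt ->]]]]|x g [a [b [t [Tt ->]]]]].
- by exists 1, 1, 1; split; [exact: tensor_like1 | rewrite !gmulf1 !mulg1].
- by exists (a * g), b, t; rewrite gmulfM mulgA.
exists a, (b * g), (t * ([~ i a, j g] ^ i a^-1) ^ j (b * g)^-1); split.
  apply: tensor_likeM => //; rewrite 2!nu_conj; exact: tensor_like_comm.
rewrite !gmulfV -!(mulgA t); congr (_ * _).
rewrite -conjgCV -(mulgA (j (b * g))) -conjgCV gmulfM -!mulgA.
by congr (_ * _); rewrite mulgA -commgC.
Qed.

(** In the decomposition [pi1] and [pi2] return [a] and [b], so [x = t]; as [pi3 t = 1], it acts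
    trivially on both copies. *)
Lemma nu_kernel_central x :
  pi1 x = 1 -> pi2 x = 1 -> pi3 x = 1 -> central x.
Proof.
have [a [b [t [[tr tl _ t1 t2] ->]]]] := nu_decomp x.
rewrite !nu_liftM !nu_lift_l !nu_lift_r t1 t2 /= !mul1g !mulg1 => -> ->.
rewrite !mulg1 !gmulf1 !mulg1 => t3 y.
elim/nu_ind: y => [|y g ty|y g ty]; first exact: commute1.
- apply: commuteM => //; apply: commute_sym.
  by rewrite /commute conjgC tl t3 gmulf1 conjg1.
- apply: commuteM => //; apply: commute_sym.
  by rewrite /commute conjgC tr t3 gmulf1 conjg1.
Qed.

End NuUniversal.

Section NuTriple.

Variable G : finGroupType.

Definition nu_triple (x : nu G) : G * G * G :=
  (nu_lift (@nu_relations_id1 G) x, nu_lift (@nu_relations_1id G) x,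
   nu_lift (@nu_relations_id G) x).

Lemma nu_tripleM : {morph nu_triple : x y / x * y}.
Proof. by move=> x y; rewrite /nu_triple !nu_liftM. Qed.

Lemma nu_triple1 : nu_triple 1 = 1.
Proof. by rewrite /nu_triple !nu_lift1. Qed.

HB.instance Definition _ :=
  isUMagmaMorphism.Build (nu G) (G * G * G)%type nu_triple (nu_triple1, nu_tripleM).

Lemma nu_triple_ker x : nu_triple x = 1 -> central x.
Proof. by case=> *; apply: nu_kernel_central. Qed.

Lemma nu_finite_pgroup (p e : nat) :
    prime p -> p.-group [set: G] -> (forall g : G, g ^+ (p ^ e) = 1) ->
  {r : seq (nu G) & (forall x, x \in r) &
                    {M | p.-nat M & forall x : nu G, x ^+ M = 1}}.
Proof.
move=> p_pr pG expG.
pose gen := [seq nu_l g | g <- enum G] ++ [seq nu_r g | g <- enum G].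
have gen_l g : nu_l g \in gen by rewrite mem_cat map_f ?mem_enum.
have gen_r g : nu_r g \in gen by rewrite mem_cat map_f ?mem_enum ?orbT.
have gen_ind (P : nu G -> Prop) : P 1 ->
    (forall x l, l \in gen -> P x -> P (x * l)) -> forall x, P x.
  by move=> P1 PM; apply: nu_ind => // x g; exact: PM.
have gen_torsion l : l \in gen -> l ^+ (p ^ e) = 1.
  by rewrite mem_cat => /orP[] /mapP[g _ ->]; rewrite -gmulfXn expG gmulf1.
have pe_gt0 : 0 < p ^ e by rewrite expn_gt0 prime_gt0.
have [r rP] := central_ext_finite nu_triple_ker gen_ind gen_torsion pe_gt0.
(* Unification sets [M] to [#|E| * (#|E| * p ^ e)], where [E] is the image in [G * G * G]; this is a
   power of [p]. *)
exists r => //; eexists; last first.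
  exact: central_ext_torsion nu_triple_ker gen_ind gen_torsion.
have pE : p.-group [set: (G * G * G)%type].
  have pG1 : p.-nat #|G| by rewrite -cardsT.
  by rewrite /pgroup cardsT !card_prod !pnatM pG1.
rewrite !pnatM pnatX pnat_id // orTb andbT andbb.
exact: pgroupS (subsetT _) pE.
Qed.

End NuTriple.

Theorem theoremB (p e : nat) (G : finGroupType)
    (p_prime : prime p) (pG : p.-group [set: G])
    (expG : exponent [set: G] = (p ^ e)%N) :
  (potent_pgroup p [set: G] ->
     exists2 n : nat, has_exponent (nu G) n & n %| (p ^ e.+1)%N) /\
  (odd p -> 'L_(p - 2)%N([set: G]) \subset power_subgroup p [set: G] ->
     is_potent_pgroup p (nu G) /\ has_exponent (nu G) (p ^ e)).
Proof.
have gG (g : G) : g ^+ (p ^ e) = 1 by rewrite -expG expg_exponent ?inE.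
have [r rP [M pM nuM]] := nu_finite_pgroup p_prime pG gG.
pose K : finGroupType := finite_copy rP.
pose i : UMagmaMorphism.type G K := @nu_l G.
pose j : UMagmaMorphism.type G K := @nu_r G.
have rel : nu_relations i j := @nu_lr_relations G.
have pK : p.-group [set: K].
  rewrite -pnat_exponent; apply: pnat_dvd pM.
  by apply/exponentP=> x _; exact: nuM.
have genK : <<(i @: [set: G]) :|: (j @: [set: G])>> = [set: K].
  apply/eqP; rewrite eqEsubset subsetT /=; apply/subsetP=> x _.
  elim/nu_ind: x => [|x g gx|x g gx]; first exact: group1.
    by apply: (groupM gx); rewrite mem_gen // inE imset_f ?inE.
  by apply: (groupM gx); rewrite mem_gen // inE orbC imset_f ?inE.
split=> [potG|p_odd sL].
  have expK : exponent [set: K] %| p ^ e.+1.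
    apply/exponentP=> x _; case/andP: potG => _; have [p2|p_neq2] := eqVneq p 2.
      by move=> sL; exact: (nu_exponent_even p_prime pK gG rel genK p2 sL).
    (* For odd [p] already [p ^ e] kills [nu G]. *)
    move=> sL; rewrite expnSr expgnA.
    rewrite (nu_exponent_odd p_prime pK gG rel genK) ?expg1n //.
    by case/even_prime: p_prime p_neq2 => // ->.
  exists (exponent [set: K]) => //; split.
  - exact: exponent_gt0.
  - by move=> x; apply: (expg_exponent (in_setT (x : K))).
  move=> m m_gt0 xm; apply: dvdn_leq => //.
  by apply/exponentP=> x _; exact: xm.
have sL1 : 'L_p.-1([set: G]) \subset power_subgroup p [set: G].
  apply: subset_trans sL; apply: lcn_sub_leq.
  by rewrite -subn1 leq_sub2l.
split.
  exists K; exists (idfun : Multiplicative.type (nu G) (nu G)).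
  split; first by exists idfun.
  exact: nu_potent p_prime pK rel genK p_odd sL.
split=> [|x|m m_gt0 xm].
- by rewrite expn_gt0 prime_gt0.
- exact: (nu_exponent_odd p_prime pK gG rel genK p_odd sL1).
(* [G] is a retract of [nu G], through [nu_l] and the lift of the identity pair, so whatever kills
   [nu G] kills [G]. *)
rewrite -expG dvdn_leq //; apply/exponentP=> g _.
rewrite -[g](nu_lift_l (@nu_relations_id G)).
by rewrite -gmulfXn xm gmulf1.
Qed.
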